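(* Let $K$ be a field, $S=K[x_1,\ldots,x_n]$, $I\subsetneq S$ a monomial ideal, and $d=\dim S/I$. Let $g\in\mathbb{N}^n$ be such that $a\leq g$ for every minimal monomial generator $x^a$ of $I$, and let $I_j$ ($0\leq j\leq d$) be the skeleton ideals of $I$ with respect to $g$. Then $$\operatorname{depth} S/I=\max\{j : 0\leq j\leq d,\ S/I_j \text{ is Cohen--Macaulay}\},$$ and $S/I_j$ is Cohen--Macaulay for all $0\leq j\leq \operatorname{depth} S/I$.
   Context: $\mathbb{N}$ denotes the nonnegative integers. For $c\in\mathbb{N}^n$, $x^c=x_1^{c(1)}\cdots x_n^{c(n)}$. The partial order on $\mathbb{N}^n$ is componentwise. For $b\in\mathbb{N}^n$, $\rho(b)=|\{i : b(i)=g(i)\}|$. For an integer $j\leq d$, the $j$th skeleton ideal $I_j$ of $I$ with respect to $g$ is the monomial ideal generated by $I$ together with all monomials $x^b$, $b\in\mathbb{N}^n$, with $\rho(b)>j$. Depth is taken with respect to $(x_1,\ldots,x_n)$. The zero module is considered to be Cohen--Macaulay. *)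

(* Defs.v *)
From mathcomp Require Import all_boot all_order all_algebra.
From mathcomp.multinomials Require Export mpoly.

Set Implicit Arguments.
Unset Strict Implicit.
Unset Printing Implicit Defensive.

Import GRing.Theory.
Local Open Scope ring_scope.

Definition is_max (P : nat -> Prop) (m : nat) : Prop :=
  P m /\ forall k : nat, P k -> (k <= m)%N.

(* Ideals are Prop-valued predicates on the ring; the quotient R/I is handled
   through I itself, so R/I = 0 means that every element of R satisfies I. *)
Section CommutativeAlgebra.
Variable R : comNzRingType.
Implicit Types (A B I J P : R -> Prop).

Definition included A B : Prop := forall x, A x -> B x.

Definition is_ideal I : Prop :=
  [/\ I 0, forall x y, I x -> I y -> I (x + y) & forall r x, I x -> I (r * x)].

Definition ideal_gen A : R -> Prop :=
  fun x => forall J, is_ideal J -> included A J -> J x.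

Definition is_prime_ideal P : Prop :=
  [/\ is_ideal P, ~ P 1 & forall x y, P (x * y) -> P x \/ P y].

(* The primes of R/I are the primes of R that contain I. *)
Definition is_prime_chain I (l : nat) (Q : nat -> R -> Prop) : Prop :=
  (forall i, (i <= l)%N -> is_prime_ideal (Q i) /\ included I (Q i)) /\
  (forall i, (i < l)%N -> included (Q i) (Q i.+1) /\ ~ included (Q i.+1) (Q i)).

(* d is the Krull dimension of R/I. *)
Definition is_dim I (d : nat) : Prop :=
  is_max (fun l : nat => exists Q : nat -> R -> Prop, is_prime_chain I l Q) d.

Definition ideal_add_seq I (s : seq R) : R -> Prop :=
  ideal_gen (fun x => I x \/ x \in s).

(* s is a regular sequence on R/I: s`_i is a nonzerodivisor on
   R/(I + (s`_0, ..., s`_(i-1))) for each i < size s, and R/(I + (s)) <> 0. *)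
Definition is_regular_seq I (s : seq R) : Prop :=
  (forall i : nat, (i < size s)%N -> forall h : R,
     ideal_add_seq I (take i s) (s`_i * h) -> ideal_add_seq I (take i s) h) /\
  ~ ideal_add_seq I s 1.

(* t is the depth of R/I with respect to the ideal J. *)
Definition is_depth J I (t : nat) : Prop :=
  is_max (fun l => exists s : seq R,
    [/\ size s = l, forall x, x \in s -> J x & is_regular_seq I s]) t.

(* R/I is Cohen-Macaulay: it is zero, or its depth with respect to J equals
   its dimension. *)
Definition is_CM J I : Prop :=
  (forall x, I x) \/ exists d : nat, is_dim I d /\ is_depth J I d.

End CommutativeAlgebra.

Section MonomialIdeals.
Variables (K : fieldType) (n : nat).
Implicit Types (I : {mpoly K[n]} -> Prop) (G : 'X_{1..n} -> Prop).

Definition max_ideal : {mpoly K[n]} -> Prop :=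
  ideal_gen (fun p : {mpoly K[n]} => exists i : 'I_n, p = 'X_i).

Definition generates G I : Prop :=
  forall p, I p <-> ideal_gen (fun q => exists2 a, G a & q = 'X_[a]) p.

Definition is_monomial_ideal I : Prop := exists G, generates G I.

Definition is_minimal_generating_set G I : Prop :=
  generates G I /\
  forall H : 'X_{1..n} -> Prop,
    generates H I -> (forall a, H a -> G a) -> forall a, G a -> H a.

Definition is_minimal_generator I (a : 'X_{1..n}) : Prop :=
  exists2 G, is_minimal_generating_set G I & G a.

Definition rho (g b : 'X_{1..n}) : nat := #|[set i : 'I_n | b i == g i]|.

Definition skeleton_ideal (g : 'X_{1..n}) I (j : nat) : {mpoly K[n]} -> Prop :=
  ideal_gen (fun p => I p \/ exists2 b, (j < rho g b)%N & p = 'X_[b]).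

End MonomialIdeals.

Arguments max_ideal : clear implicits.

(* Main.v *)
Require Import Defs.
From mathcomp Require Import all_boot all_order all_algebra.
From mathcomp Require Import ring zify.
From Stdlib Require Import FunctionalExtensionality PropExtensionality.
From Stdlib Require Import Classical ClassicalEpsilon.

Set Implicit Arguments.
Unset Strict Implicit.
Unset Printing Implicit Defensive.

Import GRing.Theory.
Local Open Scope ring_scope.

(** Let [S] be the polynomial ring, and say that the variable [i] is saturated
    in [x^c] when [g i <= c i].  As the generators of [I] divide [x^g], the
    membership of [x^c] in [I] depends only on the truncation [min(c, g)].
    Hence [dim S/I] is the largest number of saturated variables of a monomial
    outside [I], and [I_j] is [I] together with the monomials that have more
    than [j] saturated variables; so [S/I_j] is zero or of dimension [j].

    The monomials with a fixed truncation [b] span a shifted copy of [S/P_F],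
    where [F] is the set of saturated variables of [b] and the prime [P_F] is
    generated by the other variables.  Thus [I_j/I] is filtered by copies of
    [S/P_F] with [#|F| > j] ([regular_filtration]), its depth is at least
    [j + 1], and the exact sequence [0 -> I_j/I -> S/I -> S/I_j -> 0] shows that
    [depth S/I_j = min(j, depth S/I)] whenever [I_j] is proper.  This says that
    [S/I_j] is Cohen-Macaulay exactly when [j <= depth S/I].

    Comparing depths along the exact sequence has to cope with arbitrary, not
    necessarily homogeneous, regular sequences.  In one direction, a regular
    sequence of length [t] in the maximal ideal makes the Koszul cohomology on
    the variables vanish in degrees below [t] ([regular_vanishes]), and
    vanishing passes to [S/I_j] ([skeleton_vanishes]).  In the other direction,
    a universal sequence is available: the elementary symmetric polynomials
    [theta_1, theta_2, ...] in high powers of the variables.  The first [k] of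
    them are regular on every [S/P_F] with [k <= #|F|]
    ([thetas_regular_face]), hence on the kernels [I_j/I], and the first [j]
    generate an ideal primary to the maximal ideal modulo a monomial ideal of
    dimension at most [j] ([thetas_primary]).  An induction on the skeletons
    then turns vanishing cohomology into the regularity of the [theta_k]
    ([vanishes_thetas_regular]).

    The same counting argument bounds the lengths of chains of primes and of
    regular sequences: both give elements that are algebraically independent
    modulo the ideal ([cancelling_independent]), and there are too few
    monomials outside the ideal for more than [dim S/I] of them
    ([cancelling_size]). *)

(** * Ideals and regular sequences on subquotients *)

Lemma pred_ext (T : Type) (A B : T -> Prop) :
  (forall x, A x <-> B x) -> A = B.
Proof.
by move=> AB; apply: functional_extensionality => x;
   apply: propositional_extensionality.
Qed.

Definition decide (P : Prop) : bool :=
  if excluded_middle_informative P then true else false.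

Lemma decideP P : decide P <-> P.
Proof. by rewrite /decide; case: excluded_middle_informative. Qed.

Section Subquotients.
Variable R : comNzRingType.
Implicit Types (A B C E J : R -> Prop) (f h u v x : R) (s : seq R).

Definition full : R -> Prop := fun=> True.

Lemma full_ideal : is_ideal full. Proof. by []. Qed.

Lemma ideal0 A : is_ideal A -> A 0. Proof. by case. Qed.

Lemma idealD A u v : is_ideal A -> A u -> A v -> A (u + v).
Proof. by case=> _ AD _; apply: AD. Qed.

Lemma idealM A r u : is_ideal A -> A u -> A (r * u).
Proof. by case=> _ _; apply. Qed.

Lemma ideal_mulr A r u : is_ideal A -> A u -> A (u * r).
Proof. by rewrite mulrC; apply: idealM. Qed.

Lemma idealN A u : is_ideal A -> A u -> A (- u).
Proof. by move=> Ai; rewrite -mulN1r; apply: idealM. Qed.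

Lemma idealB A u v : is_ideal A -> A u -> A v -> A (u - v).
Proof. by move=> Ai Au Av; apply: idealD => //; apply: idealN. Qed.

Lemma ideal_sum A (T : Type) (r : seq T) (P : pred T) (F : T -> R) :
  is_ideal A -> (forall i, P i -> A (F i)) -> A (\sum_(i <- r | P i) F i).
Proof. by move=> Ai AF; elim/big_ind: _ => //; [case: Ai|case: Ai]. Qed.

Lemma idealBr A u v : is_ideal A -> A (u - v) -> A v -> A u.
Proof. by move=> Ai Auv Av; rewrite -(subrK v u); apply: idealD. Qed.

Lemma ideal_gen_ideal A : is_ideal (ideal_gen A).
Proof.
split=> [J []//|u v Au Av J Ji AJ|r u Au J Ji AJ].
  by apply: idealD => //; [apply: Au|apply: Av].
by apply: idealM => //; apply: Au.
Qed.

Lemma ideal_gen_sub A : included A (ideal_gen A).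
Proof. by move=> x Ax J _; apply. Qed.

(** For ideals [B] inside [A] that represent the module [A/B], this is the
    ideal [C] for which [A/C] is [(A/B)/f(A/B)]. *)
Definition addmul A B f : R -> Prop :=
  fun x => exists b a, [/\ B b, A a & x = b + f * a].

Lemma addmul_ideal A B f : is_ideal A -> is_ideal B -> is_ideal (addmul A B f).
Proof.
move=> Ai Bi; split=> [|x y [b [a [Bb Aa ->]]] [c [e [Bc Ae ->]]]
                      |r x [b [a [Bb Aa ->]]]].
- by exists 0, 0; split; [case: Bi|case: Ai|rewrite mulr0 addr0].
- by exists (b + c), (a + e); split; [exact: idealD|exact: idealD|ring].
- by exists (r * b), (r * a); split; [exact: idealM|exact: idealM|ring].
Qed.

Lemma addmul_subl A B f : is_ideal A -> included B (addmul A B f).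
Proof.
by move=> Ai b Bb; exists b, 0; split=> //; [case: Ai|rewrite mulr0 addr0].
Qed.

Lemma addmul_mul A B f u : is_ideal B -> A u -> addmul A B f (f * u).
Proof. by move=> Bi Au; exists 0, u; split=> //; [case: Bi|rewrite add0r]. Qed.

Lemma addmul_sub A B f :
  is_ideal A -> included B A -> included (addmul A B f) A.
Proof.
move=> Ai BA x [b [a [Bb Aa ->]]].
by apply: idealD => //; [apply: BA|apply: idealM].
Qed.

Lemma addmulC A B f h : addmul A (addmul A B f) h = addmul A (addmul A B h) f.
Proof.
have sub f' h' x : addmul A (addmul A B f') h' x ->
    addmul A (addmul A B h') f' x.
  move=> [_ [a [[b [c [Bb Ac ->]]] Aa ->]]].
  by exists (b + h' * a), c; split=> //; [exists b, a|rewrite addrAC].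
by apply: pred_ext => x; split; apply: sub.
Qed.

Definition addmuls A B s := foldl (addmul A) B s.

Lemma addmuls_ideal A B s :
  is_ideal A -> is_ideal B -> is_ideal (addmuls A B s).
Proof. by move=> Ai; elim: s B => //= f s IHs B Bi; apply/IHs/addmul_ideal. Qed.

Lemma addmuls_subl A B s : is_ideal A -> included B (addmuls A B s).
Proof.
move=> Ai; elim: s B => [|f s IHs] B x //= Bx.
by apply: IHs; apply: addmul_subl.
Qed.

Lemma addmuls_mem B s f :
  is_ideal B -> f \in s -> addmuls full B s f.
Proof.
move=> Bi; elim: s B Bi => //= h s IHs B Bi.
have hBi := addmul_ideal h full_ideal Bi.
rewrite inE => /orP[/eqP->|]; last exact: IHs.
apply: addmuls_subl => //.
by have := @addmul_mul full B h 1 Bi I; rewrite mulr1.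
Qed.

Lemma addmuls_min B s J : is_ideal J -> included B J ->
  (forall f, f \in s -> J f) -> included (addmuls full B s) J.
Proof.
move=> Ji; elim: s B => //= f s IHs B BJ sJ; apply: IHs => [x|h hs].
  move=> [b [a [Bb _ ->]]]; apply: idealD => //; first exact: BJ.
  by apply: ideal_mulr => //; apply: sJ; rewrite mem_head.
by apply: sJ; rewrite inE hs orbT.
Qed.

Definition nonzerodivisor A B f := forall u, A u -> B (f * u) -> B u.

Lemma nonzerodivisorM B f h :
  nonzerodivisor full B f -> nonzerodivisor full B h ->
  nonzerodivisor full B (f * h).
Proof. by move=> nzf nzh u _; rewrite -mulrA => /nzf/nzh; apply. Qed.

Lemma nonzerodivisor1 B :
  nonzerodivisor full B 1.
Proof. by move=> u _; rewrite mul1r. Qed.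

Fixpoint regular A B s : Prop :=
  if s is f :: s' then nonzerodivisor A B f /\ regular A (addmul A B f) s'
  else True.

Lemma regular_rcons A B s f :
  regular A B (rcons s f) <->
  regular A B s /\ nonzerodivisor A (addmuls A B s) f.
Proof.
elim: s B => [|h s IHs] B /=; first by split=> [[]|[]].
by split=> [[? /IHs[]]|[[? ?] ?]] //; split=> //; apply/IHs.
Qed.

Lemma regular_trivial A B s :
  is_ideal A -> included A B -> regular A B s.
Proof.
move=> Ai; elim: s B => //= f s IHs B AB; split=> [u /AB//|].
by apply: IHs => x /AB Bx; apply: addmul_subl.
Qed.

(** Regularity is a property of the module: multiplication by [m] is required
    to induce an isomorphism from [A0/B0] onto [A/B].  With [m = 1] this covers
    the second isomorphism theorem, and with a monomial [m] a shifted copy of a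
    cyclic module. *)
Lemma regular_iso (A0 B0 A B : R -> Prop) m s :
    is_ideal A0 -> is_ideal B0 -> is_ideal A -> is_ideal B -> included B0 A0 ->
    (forall u, A u -> exists2 h, A0 h & B (u - m * h)) ->
    (forall h, A0 h -> A (m * h)) ->
    (forall h, A0 h -> B (m * h) <-> B0 h) ->
  regular A0 B0 s -> regular A B s.
Proof.
move=> A0i + Ai; elim: s B0 B => //= f s IHs B0 B B0i Bi BA0 surj inA Bm.
move=> [nzf regs]; split=> [u Au Bfu|].
  have [h A0h Buh] := surj u Au.
  apply: (idealBr Bi Buh); apply/Bm => //; apply: nzf => //; apply/Bm.
    exact: idealM.
  have -> : m * (f * h) = f * u - f * (u - m * h) by ring.
  by apply: idealB => //; apply: idealM.
apply: IHs regs => //; [exact: addmul_ideal|exact: addmul_ideal| | |].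
- exact: addmul_sub.
- by move=> u /surj[h A0h Buh]; exists h => //; apply: addmul_subl.
move=> h A0h.
split=> [[b [a [Bb /surj[h' A0h' Ba] e]]]|[b [a [B0b A0a ->]]]].
  exists (h - f * h'), h'; split=> //; last by rewrite subrK.
  apply/Bm; first by apply: idealB => //; apply: idealM.
  have -> : m * (h - f * h') = b + f * (a - m * h') by rewrite mulrBr e; ring.
  by apply: idealD => //; apply: idealM.
exists (m * b), (m * a); split; [|exact: inA|by ring].
by apply/Bm => //; apply: BA0.
Qed.

(** The horseshoe argument for [0 -> C/B -> A/B -> A/C -> 0].  Dividing by a
    nonzerodivisor on [A/C] keeps the sequence exact, since
    [C] meets [B + f A] in [B + f C]. *)
Lemma regular_extension A B C s :
    is_ideal A -> is_ideal B -> is_ideal C -> included B C -> included C A ->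
  regular C B s -> regular A C s -> regular A B s.
Proof.
move=> Ai; elim: s B C => //= f s IHs B C Bi Ci BC CA [nzCB regCB] [nzAC regAC].
split=> [u Au Bfu|]; first by apply: nzCB => //; apply: nzAC => //; apply: BC.
apply: (IHs _ (addmul A C f)); try exact: addmul_ideal.
- by move=> x [b [a [Bb Aa ->]]]; exists b, a; split=> //; apply: BC.
- exact: addmul_sub.
- apply: (@regular_iso C (addmul C B f) _ _ 1) => //; try exact: addmul_ideal.
  + exact: addmul_sub.
  + move=> _ [c [a [Cc Aa ->]]]; exists c => //.
    by rewrite mul1r addrAC subrr add0r; apply: addmul_mul.
  + by move=> h Ch; rewrite mul1r; apply: addmul_subl.
  + move=> h Ch; rewrite mul1r; split=> [[b [a [Bb Aa e]]]|[b [c [Bb Cc ->]]]].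
      exists b, a; split=> //; apply: nzAC => //.
      have -> : f * a = h - b by rewrite e; ring.
      by apply: idealB => //; apply: BC.
    by exists b, c; split=> //; apply: CA.
exact: regAC.
Qed.

Lemma ideal_add_seqE J s : is_ideal J -> ideal_add_seq J s = addmuls full J s.
Proof.
move=> Ji; apply: pred_ext => x; split=> [gx|].
  apply: gx => [|y [Jy|ys]]; first exact: addmuls_ideal.
    exact: addmuls_subl.
  exact: addmuls_mem.
apply: addmuls_min; first exact: ideal_gen_ideal.
  by move=> y Jy; apply: ideal_gen_sub; left.
by move=> f fs; apply: ideal_gen_sub; right.
Qed.

Lemma regularP A B s :
  regular A B s <-> forall i, (i < size s)%N ->
    nonzerodivisor A (addmuls A B (take i s)) s`_i.
Proof.
elim: s B => [|f s IHs] B; first by [].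
split=> /= [[nzf /IHs regs] [|i] //=|regs]; first by rewrite ltnS; apply: regs.
split; first exact: (regs 0%N).
by apply/IHs => i lt_i; apply: (regs i.+1).
Qed.

Lemma is_regular_seqE J s : is_ideal J ->
  is_regular_seq J s <-> regular full J s /\ ~ addmuls full J s 1.
Proof.
move=> Ji; rewrite /is_regular_seq ideal_add_seqE //.
have E i : ideal_add_seq J (take i s) = addmuls full J (take i s).
  exact: ideal_add_seqE.
split=> -[regs ?]; split=> //.
  by apply/regularP => i /regs; rewrite E => nz h _; apply: nz.
by move=> i /((regularP _ _ _).1 regs i); rewrite E => nz h; apply: nz.
Qed.

End Subquotients.

Arguments full {R}.
Arguments full_ideal {R}.

(** * Koszul cohomology *)

Section Koszul.
Variable R : comNzRingType.
Implicit Types (A B C : R -> Prop) (f x r : R) (xs s : seq R) (p q : nat).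

(** The Koszul complex on [xs], without its grading, as an iterated mapping
    cone: adding [x] turns the complex [L] into [L * L], with differential
    [(a, b) |-> (d a, x a - d b)].  No signs indexed by subsets are needed. *)
Fixpoint koszul xs : lmodType R :=
  if xs is _ :: xs' then (koszul xs' * koszul xs')%type else R^o.

Fixpoint diff xs : koszul xs -> koszul xs :=
  match xs with
  | [::] => fun=> 0
  | x :: xs' => fun z => (diff z.1, x *: z.1 - diff z.2)
  end.

Fixpoint coefs_in A xs : koszul xs -> Prop :=
  match xs with
  | [::] => fun z => A z
  | x :: xs' => fun z => coefs_in A z.1 /\ coefs_in A z.2
  end.

(** [in_degree p z] says that [z] is homogeneous of cohomological degree
    [p - 1].  The shift makes the first index the zero module, so that the
    induction on degrees starts with a trivial case. *)
Fixpoint in_degree p xs : koszul xs -> Prop :=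
  match xs with
  | [::] => fun z => p = 1%N \/ z = 0
  | x :: xs' => fun z => in_degree p z.1 /\ in_degree p.-1 z.2
  end.

Lemma diff_linear xs : linear (@diff xs).
Proof.
elim: xs => [|x xs IHs] r u v /=; first by rewrite scaler0 addr0.
apply: injective_projections; rewrite /= !IHs //.
by rewrite !scalerDr scalerN opprD addrACA !scalerA mulrC.
Qed.

Lemma diffD xs (u v : koszul xs) : diff (u + v) = diff u + diff v.
Proof. by rewrite -[u]scale1r diff_linear !scale1r. Qed.

Lemma diff0 xs : diff (0 : koszul xs) = 0.
Proof. by apply: (addIr (diff 0)); rewrite -diffD !add0r. Qed.

Lemma diffZ xs r (u : koszul xs) : diff (r *: u) = r *: diff u.
Proof. by rewrite -[r *: u]addr0 diff_linear diff0 addr0. Qed.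

Lemma diffN xs (u : koszul xs) : diff (- u) = - diff u.
Proof. by rewrite -scaleN1r diffZ scaleN1r. Qed.

Lemma diffB xs (u v : koszul xs) : diff (u - v) = diff u - diff v.
Proof. by rewrite diffD diffN. Qed.

Lemma diffK xs (z : koszul xs) : diff (diff z) = 0.
Proof.
elim: xs z => [|x xs IHs] //= -[a b] /=.
by rewrite IHs diffB diffZ IHs subr0 subrr.
Qed.

Section Coefs.
Variables (A : R -> Prop) (Ai : is_ideal A).

Lemma coefs_in0 xs : coefs_in A (0 : koszul xs).
Proof. by elim: xs => [|x xs IHs] /=; [case: Ai|split]. Qed.

Lemma coefs_inD xs (u v : koszul xs) :
  coefs_in A u -> coefs_in A v -> coefs_in A (u + v).
Proof.
elim: xs u v => [|x xs IHs] u v /=; first exact: idealD.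
by move=> [? ?] [? ?]; split; apply: IHs.
Qed.

Lemma coefs_inZ xs r (u : koszul xs) : coefs_in A u -> coefs_in A (r *: u).
Proof.
elim: xs u => [|x xs IHs] u /=; first exact: idealM.
by move=> [? ?]; split; apply: IHs.
Qed.

Lemma coefs_inB xs (u v : koszul xs) :
  coefs_in A u -> coefs_in A v -> coefs_in A (u - v).
Proof.
by move=> Au Av; apply: coefs_inD => //; rewrite -scaleN1r; apply: coefs_inZ.
Qed.

Lemma coefs_in_diff xs (u : koszul xs) : coefs_in A u -> coefs_in A (diff u).
Proof.
elim: xs u => [|x xs IHs] u /=; first by case: Ai.
move=> [Au1 Au2]; split; first exact: IHs.
by apply: coefs_inB; [apply: coefs_inZ|apply: IHs].
Qed.

End Coefs.

Lemma coefs_in_sub A B xs (z : koszul xs) :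
  included A B -> coefs_in A z -> coefs_in B z.
Proof.
move=> AB; elim: xs z => [|x xs IHs] z /=; first exact: AB.
by case; split; apply: IHs.
Qed.

Lemma coefs_in_full xs (z : koszul xs) : coefs_in full z.
Proof. by elim: xs z => [|x xs IHs] z /=; split. Qed.

Lemma coefs_in_nonzerodivisor A B f xs (z : koszul xs) :
  nonzerodivisor A B f -> coefs_in A z -> coefs_in B (f *: z) -> coefs_in B z.
Proof.
move=> nzf; elim: xs z => [|x xs IHs] z /=; first exact: nzf.
by case=> ? ? [? ?]; split; apply: IHs.
Qed.

Lemma coefs_in_mul A B f xs (z : koszul xs) :
  is_ideal B -> coefs_in A z -> coefs_in (addmul A B f) (f *: z).
Proof.
move=> Bi; elim: xs z => [|x xs IHs] z /=; first exact: addmul_mul.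
by case=> /IHs ? /IHs.
Qed.

Lemma in_degree_0 p xs : in_degree p (0 : koszul xs).
Proof. by elim: xs p => [|x xs IHs] p /=; [right|split]. Qed.

Lemma in_degree0 xs (z : koszul xs) : in_degree 0 z -> z = 0.
Proof.
by elim: xs z => [|x xs IHs] z /=; [case|case: z => a b [/IHs/= -> /IHs/= ->]].
Qed.

Lemma in_degreeD p xs (u v : koszul xs) :
  in_degree p u -> in_degree p v -> in_degree p (u + v).
Proof.
elim: xs p u v => [|x xs IHs] p u v /=.
  by case=> [->|->]; [left|rewrite add0r].
by case=> ? ? [? ?]; split; apply: IHs.
Qed.

Lemma in_degreeZ p r xs (u : koszul xs) : in_degree p u -> in_degree p (r *: u).
Proof.
elim: xs p u => [|x xs IHs] p u /=.
  by case=> [->|->]; [left|right; rewrite scaler0].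
by case=> ? ?; split; apply: IHs.
Qed.

Lemma in_degreeB p xs (u v : koszul xs) :
  in_degree p u -> in_degree p v -> in_degree p (u - v).
Proof.
by move=> ? ?; apply: in_degreeD => //; rewrite -scaleN1r; apply: in_degreeZ.
Qed.

Lemma in_degree_diff p xs (z : koszul xs) :
  in_degree p z -> in_degree p.+1 (diff z).
Proof.
elim: xs p z => [|x xs IHs] p z /=; first by right.
case=> z1 z2; split; first exact: IHs.
apply: in_degreeB; first exact: in_degreeZ.
case: p z1 z2 => [_ /in_degree0 ->|p _]; last exact: IHs.
by rewrite diff0; apply: in_degree_0.
Qed.

Lemma in_degree_diff_pred p xs (z : koszul xs) :
  in_degree p.-1 z -> in_degree p (diff z).
Proof.
case: p => [/in_degree0 ->|p]; last exact: in_degree_diff.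
by rewrite diff0; apply: in_degree_0.
Qed.

Lemma coefs_in_addmul A B f p xs (z : koszul xs) :
    is_ideal A -> is_ideal B -> in_degree p z -> coefs_in (addmul A B f) z ->
  exists b a, [/\ in_degree p a, coefs_in B b, coefs_in A a & z = b + f *: a].
Proof.
move=> Ai Bi; elim: xs p z => [|x xs IHs] p z /=.
  case=> [-> [b [a [Bb Aa ->]]]|-> _]; first by exists b, a; split; [left| | |].
  by exists 0, 0; split; [right|case: Bi|case: Ai|rewrite scaler0 addr0].
case: z => z1 z2 /= [/IHs dz1 /IHs dz2] [/dz1[b1 [a1 [? ? ? ->]]]].
case/dz2 => b2 [a2 [? ? ? ->]].
by exists (b1, b2), (a1, a2).
Qed.

(** Multiplication by an element [f] of the ideal generated by [xs] is
    homotopic to zero. *)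
Definition null_homotopic xs f := exists2 h : koszul xs -> koszul xs,
  linear h & [/\ forall z, diff (h z) + h (diff z) = f *: z,
    forall A z, is_ideal A -> coefs_in A z -> coefs_in A (h z) &
    forall p z, in_degree p.+1 z -> in_degree p (h z)].

Lemma null_homotopic_ideal xs : is_ideal (null_homotopic xs).
Proof.
split=> [|f1 f2 [h1 l1 [e1 A1 d1]] [h2 l2 [e2 A2 d2]]|r f [h l [e A d]]].
- exists (fun=> 0) => [|]; first by move=> r u v; rewrite scaler0 addr0.
  split=> [z|B z Bi _|p z _]; first by rewrite diff0 addr0 scale0r.
    exact: coefs_in0.
  exact: in_degree_0.
- exists (fun z => h1 z + h2 z) => [r u v|].
    by rewrite l1 l2 scalerDr addrACA.
  split=> [z|B z Bi Bz|p z dz]; first by rewrite diffD addrACA e1 e2 scalerDl.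
    by apply: coefs_inD => //; [apply: A1|apply: A2].
  by apply: in_degreeD; [apply: d1|apply: d2].
exists (fun z => r *: h z) => [c u v|].
  by rewrite l scalerDr !scalerA mulrC.
split=> [z|B z Bi Bz|p z dz].
- by rewrite diffZ -scalerDr e scalerA.
- by apply: coefs_inZ => //; apply: A.
- by apply: in_degreeZ; apply: d.
Qed.

Lemma linear_scale (M : lmodType R) (h : M -> M) r u :
  linear h -> h (r *: u) = r *: h u.
Proof.
move=> l; have h0 : h 0 = 0.
  by apply: (addIr (h 0)); have := l 1 0 0; rewrite scaler0 addr0 scale1r add0r.
by have := l r u 0; rewrite h0 !addr0.
Qed.

Lemma null_homotopic_var xs f : f \in xs -> null_homotopic xs f.
Proof.
elim: xs => // x xs IHs; rewrite inE => /orP[/eqP->|/IHs[h l [e A d]]].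
  exists (fun z => (z.2, 0)) => [r u v|].
    by apply: injective_projections; rewrite /= ?scaler0 ?addr0.
  split=> [[a b]|B z Bi [_ Bz]|p z [_ dz]] /=.
  - apply: injective_projections; rewrite /= ?diff0 ?subr0 ?addr0 //.
    by rewrite addrC subrK.
  - by split=> //; apply: coefs_in0.
  - by split=> //; apply: in_degree_0.
exists (fun z => (h z.1, - h z.2)) => [r u v|].
  apply: injective_projections => /=; rewrite l //.
  by rewrite opprD scalerN.
split=> [[a b]|B z Bi [Bz1 Bz2]|p z [dz1 dz2]] /=.
- apply: injective_projections => /=; rewrite ?e //.
  rewrite diffN opprK.
  have -> : h (x *: a - diff b) = x *: h a - h (diff b).
    by rewrite l -[- diff b]scaleN1r linear_scale // scaleN1r.
  by rewrite opprB [x *: _ + _]addrC addrACA subrr addr0 e.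
- split; first exact: A.
  by rewrite -scaleN1r; apply: coefs_inZ => //; apply: A.
split; first exact: d.
rewrite -scaleN1r; apply: in_degreeZ; case: p {dz1} dz2 => [/in_degree0 ->|p].
  by rewrite -(scale0r 0) linear_scale // scale0r; apply: in_degree_0.
exact: d.
Qed.

Lemma gen_null_homotopic xs f :
  ideal_gen (fun x => x \in xs) f -> null_homotopic xs f.
Proof. by apply; [exact: null_homotopic_ideal|exact: null_homotopic_var]. Qed.

Variable xs : seq R.

(** Vanishing of the Koszul cohomology of [A/B] in degree [p - 1]. *)
Definition vanishes p A B := forall z : koszul xs,
  in_degree p z -> coefs_in A z -> coefs_in B (diff z) ->
  exists w, [/\ in_degree p.-1 w, coefs_in A w & coefs_in B (z - diff w)].

Lemma vanishes0 A B : is_ideal A -> is_ideal B -> vanishes 0 A B.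
Proof.
move=> Ai Bi z /in_degree0 -> _ _; exists 0.
by split; rewrite ?diff0 ?subr0; [exact: in_degree_0|exact: coefs_in0..].
Qed.

(** A piece of the long exact sequence of [0 -> A/B -> A/B -> A/(B + f A) -> 0],
    in which multiplication by [f] induces zero on cohomology. *)
Lemma vanishes_lift A B f p :
    is_ideal A -> is_ideal B -> included B A ->
    ideal_gen (fun x => x \in xs) f -> nonzerodivisor A B f ->
  vanishes p A (addmul A B f) -> vanishes p.+1 A B.
Proof.
move=> Ai Bi BA /gen_null_homotopic[h _ [e hA hd]] nzf V z dz Az Bdz.
have Bf : included B (addmul A B f) by exact: addmul_subl.
have fAi := addmul_ideal f Ai Bi.
have Dh : diff (h z) = f *: z - h (diff z) by rewrite -e addrK.
have Bhdz : coefs_in B (h (diff z)) by apply: hA.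
have [||w [dw Aw]] := V (h z) (hd _ _ dz); first exact: hA.
  rewrite Dh; apply: coefs_inB => //; first exact: coefs_in_mul.
  exact: coefs_in_sub Bf _.
have dhw : in_degree p (h z - diff w).
  by apply: in_degreeB; [apply: hd|apply: in_degree_diff_pred].
case/(coefs_in_addmul Ai Bi dhw) => b [y [dy Bb Ay hE]].
exists y; split=> //; apply: (coefs_in_nonzerodivisor nzf).
  by apply: coefs_inB => //; apply: coefs_in_diff.
have -> : f *: (z - diff y) = diff b + h (diff z).
  have := congr1 (@diff xs) hE; rewrite diffB diffK subr0 diffD diffZ Dh => E.
  by rewrite scalerBr -[f *: z](subrK (h (diff z))) E addrAC addrK.
by apply: coefs_inD => //; apply: coefs_in_diff.
Qed.

Lemma vanishes_quotient A B f p :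
    is_ideal A -> is_ideal B -> nonzerodivisor A B f ->
  vanishes p A B -> vanishes p.+1 A B -> vanishes p A (addmul A B f).
Proof.
move=> Ai Bi nzf Vp Vp1 z dz Az fdz.
have fAi := addmul_ideal f Ai Bi.
have [b [y [dy Bb Ay Edz]]] := coefs_in_addmul Ai Bi (in_degree_diff dz) fdz.
have Bdy : coefs_in B (diff y).
  apply: (coefs_in_nonzerodivisor nzf); first exact: coefs_in_diff.
  have := diffK z; rewrite Edz diffD diffZ => /eqP.
  rewrite addrC addr_eq0 => /eqP ->; rewrite -scaleN1r; apply: coefs_inZ => //.
  exact: coefs_in_diff.
have [w /= [dw Aw By]] := Vp1 y dy Ay Bdy.
have [|||v [dv Av Bv]] := Vp (z - f *: w).
- by apply: in_degreeB => //; apply: in_degreeZ.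
- by apply: coefs_inB => //; apply: coefs_inZ.
- rewrite diffB diffZ Edz -addrA -scalerBr.
  by apply: coefs_inD => //; apply: coefs_inZ.
exists v; split=> //.
have -> : z - diff v = (z - f *: w - diff v) + f *: w by rewrite addrAC subrK.
apply: coefs_inD => //; first by apply: coefs_in_sub Bv; apply: addmul_subl.
exact: coefs_in_mul.
Qed.

Lemma vanishes_subquotient A B C p :
    is_ideal A -> is_ideal B -> is_ideal C -> included B C -> included C A ->
  vanishes p A B -> vanishes p.+1 C B -> vanishes p A C.
Proof.
move=> Ai Bi Ci BC CA VAB VCB z dz Az Cdz.
have [|w /= [dw Cw Bw]] := VCB (diff z) (in_degree_diff dz) Cdz.
  by rewrite diffK; apply: coefs_in0.
have [|||v [dv Av Bv]] := VAB (z - w).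
- exact: in_degreeB.
- by apply: coefs_inB => //; apply: coefs_in_sub Cw.
- by rewrite diffB.
exists v; split=> //.
have -> : z - diff v = (z - w - diff v) + w by rewrite addrAC subrK.
by apply: coefs_inD => //; apply: coefs_in_sub Bv.
Qed.

(** The Koszul form of the inequality between the length of a regular sequence
    and the depth. *)
Lemma regular_vanishes A B s p :
    is_ideal A -> is_ideal B -> included B A ->
    (forall f, f \in s -> ideal_gen (fun x => x \in xs) f) ->
  regular A B s -> (p <= size s)%N -> vanishes p A B.
Proof.
move=> Ai; elim: s B p => [|f s IHs] B [|p] Bi BA sm //=.
- by move=> _ _; apply: vanishes0.
- by move=> _ _; apply: vanishes0.
case=> nzf regs lt_ps; apply: (@vanishes_lift A B f) => //.
  by apply: sm; rewrite mem_head.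
apply: IHs => //; [exact: addmul_ideal|exact: addmul_sub|].
by move=> h hs; apply: sm; rewrite inE hs orbT.
Qed.

Lemma vanishes_quotient_seq A B s p :
    is_ideal A -> is_ideal B -> regular A B s ->
    (forall q, (q <= p + size s)%N -> vanishes q A B) ->
  forall q, (q <= p)%N -> vanishes q A (addmuls A B s).
Proof.
move=> Ai; elim: s B => [|f s IHs] B Bi /=.
  by move=> _ V q le_qp; apply: V; rewrite addn0.
case=> nzf regs V; apply: IHs => //; first exact: addmul_ideal.
move=> q le_q; apply: vanishes_quotient => //; apply: V.
  by rewrite addnS leqW.
by rewrite addnS ltnS.
Qed.

(** In degree zero, the vanishing says that the socle of [R/B] with respect to
    [xs] is zero. *)
Lemma vanishes1_socle B u :
    is_ideal B -> vanishes 1 full B ->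
  (forall x, x \in xs -> B (x * u)) -> B u.
Proof.
move=> Bi V Bu.
pose fix emb l : koszul l :=
  match l return koszul l with [::] => u | _ :: l' => (emb l', 0) end.
have emb_deg l : in_degree 1 (emb l).
  by elim: l => [|x l IHl] /=; [left|split=> //; apply: in_degree_0].
have emb_diff l : (forall x, x \in l -> B (x * u)) -> coefs_in B (diff (emb l)).
  elim: l => [|x l IHl] /= Bl; first by case: Bi.
  split; first by apply: IHl => y yl; apply: Bl; rewrite inE yl orbT.
  rewrite diff0 subr0; have {}Bl := Bl x (mem_head _ _).
  elim: l {IHl} => [|y l IHl] //=; split=> //.
  by rewrite scaler0; apply: coefs_in0.
have [|w [/in_degree0 -> _]] := V _ (emb_deg xs) (coefs_in_full _).
  exact: emb_diff.
rewrite diff0 subr0 => {V Bu}.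
by elim: (xs) => [|x l IHl] //= [/IHl].
Qed.

End Koszul.

(** * Monomial ideals *)

Section MonomialIdeals.
Variables (K : fieldType) (n : nat).
Implicit Types (U : pred 'X_{1..n}) (p q : {mpoly K[n]}) (a b c g : 'X_{1..n}).

Definition upward U := forall c e, U c -> U (c + e)%MM.

Definition monomial_ideal U : {mpoly K[n]} -> Prop :=
  fun p => forall c, c \in msupp p -> U c.

Lemma upward_le U b c : upward U -> (b <= c)%MM -> U b -> U c.
Proof. by move=> upU le_bc Ub; rewrite -(submK le_bc) addmC; apply: upU. Qed.

Lemma monomial_idealP U p :
  monomial_ideal U p <-> forall c, ~~ U c -> p@_c = 0.
Proof.
split=> [Up c|Up c]; first by apply: contraNeq; rewrite -mcoeff_msupp => /Up.
by rewrite mcoeff_msupp; apply: contraNT => /Up ->.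
Qed.

Lemma monomial_ideal_ideal U : upward U -> is_ideal (monomial_ideal U).
Proof.
move=> upU; split=> [c|p q Up Uq c|r p Up c]; first by rewrite msupp0.
  by move/msuppD_le; rewrite mem_cat => /orP[/Up|/Uq].
case/msuppM_le/allpairsP => -[c1 c2] [/= _ /Up Uc2 ->].
by rewrite addmC; apply: upU.
Qed.

Lemma monomial_idealX U c : monomial_ideal U 'X_[c] <-> U c.
Proof.
split=> [|Uc e]; last by rewrite msuppX inE => /eqP->.
by apply; rewrite msuppX inE.
Qed.

Lemma monomial_ideal_sub U U' :
  (forall c, U c -> U' c) -> included (monomial_ideal U) (monomial_ideal U').
Proof. by move=> UU' p Up c /Up/UU'. Qed.

Lemma monomial_ideal1 U : monomial_ideal U 1 <-> U 0%MM.
Proof. by rewrite -mpolyX0; apply: monomial_idealX. Qed.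

End MonomialIdeals.

(** * Regular sequences and chains of primes are bounded by the dimension *)

(** An abstraction of both a regular sequence on [R/B] and a chain of primes
    above [B]: each [f] is a nonzerodivisor modulo the current ideal, and
    belongs to the next one. *)
Fixpoint cancelling (R : comNzRingType) (B : R -> Prop) (s : seq R) : Prop :=
  if s is f :: s' then (forall h, B (f * h) -> B h) /\
    exists B', [/\ is_ideal B', included B B', B' f & cancelling B' s']
  else ~ B 1.

Lemma regular_cancelling (R : comNzRingType) (B : R -> Prop) (s : seq R) :
  is_ideal B -> regular full B s -> ~ addmuls full B s 1 -> cancelling B s.
Proof.
elim: s B => [|f s IHs] B //= Bi [nzf regs] n1.
split=> [h Bfh|]; first exact: nzf.
exists (addmul full B f); split=> //; first exact: addmul_ideal.
- exact: addmul_subl.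
- by have := @addmul_mul _ full B f 1 Bi I; rewrite mulr1.
by apply: IHs => //; apply: addmul_ideal.
Qed.

Lemma prime_chain_cancelling (R : comNzRingType) (B : R -> Prop) l Q :
  is_prime_chain B l Q -> exists2 s, size s = l & cancelling (Q 0%N) s.
Proof.
elim: l Q => [|l IHl] Q [prQ incQ].
  by exists [::] => //; case: (prQ 0%N (leqnn _)) => -[].
have [|s ss sec] := IHl (fun i => Q i.+1).
  by split=> i il; [apply: prQ|apply: incQ].
have [[Q0i _ prQ0] _] := prQ 0%N isT.
have [[Q1i _ _] _] := prQ 1%N isT.
have [Q01 nQ10] := incQ 0%N isT.
have [f nQf] := not_all_ex_not _ (fun f => Q 1%N f -> Q 0%N f) nQ10.
have [Q1f Q0f] := imply_to_and _ _ nQf.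
exists (f :: s) => /=; first by rewrite ss.
by split=> [h /prQ0[]//|]; exists (Q 1%N).
Qed.

Fixpoint exponents (l N : nat) : seq (seq nat) :=
  if l is l'.+1 then [seq k :: e | k <- iota 0 N, e <- exponents l' N]
  else [:: [::]].

Fixpoint power_product (R : comNzRingType) (s : seq R) (e : seq nat) : R :=
  match s, e with
  | f :: s', k :: e' => f ^+ k * power_product s' e'
  | _, _ => 1
  end.

Lemma size_exponents l N : size (exponents l N) = (N ^ l)%N.
Proof. by elim: l => //= l IHl; rewrite size_allpairs size_iota IHl expnS. Qed.

Lemma uniq_exponents l N : uniq (exponents l N).
Proof.
elim: l => [//|l IHl]; rewrite [exponents _ _]/=.
apply: allpairs_uniq => //; first exact: iota_uniq.
by move=> [? ?] [? ?] _ _ /= [-> ->].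
Qed.

Section Independence.
Variables (K : fieldType) (n N : nat).
Implicit Types (s : seq {mpoly K[n]}) (B : {mpoly K[n]} -> Prop).
Implicit Types (v : seq nat -> K).

Definition combination s v : {mpoly K[n]} :=
  \sum_(e <- exponents (size s) N) v e *: power_product s e.

(** The elements of the sequence are algebraically independent modulo [B]:
    grouping a relation by powers of the first element [f], the part free of
    [f] lies in the next ideal, hence vanishes, and then [f] can be
    cancelled. *)
Lemma cancelling_independent B s v :
    is_ideal B -> cancelling B s -> B (combination s v) ->
  forall e, e \in exponents (size s) N -> v e = 0.
Proof.
elim: s B v => [|f s IHs] B v Bi /=.
  rewrite /combination big_seq1 /= => n1 Bv e; rewrite inE => /eqP->.
  apply/eqP; apply/negP => /negP nz; apply: n1.
  have := idealM (v [::])^-1%:MP Bi Bv.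
  by rewrite mul_mpolyC scalerA mulVf // scale1r.
case=> nzf [B' [B'i BB' B'f sec]].
have comb0 w : (forall e, e \in exponents (size s) N -> w e = 0) ->
    combination s w = 0.
  by move=> w0; apply: big1_seq => e /w0 ->; rewrite scale0r.
have step M (w : nat -> seq nat -> K) :
    B (\sum_(k < M) f ^+ k * combination s (w k)) ->
    forall k, (k < M)%N -> forall e, e \in exponents (size s) N -> w k e = 0.
  elim: M w => // M IHM w; rewrite big_ord_recl expr0 mul1r.
  under eq_bigr => k _ do rewrite exprS -mulrA.
  rewrite -mulr_sumr; set T := \sum_(_ < M) _ => Bw.
  have w0 : forall e, e \in exponents (size s) N -> w 0%N e = 0.
    apply: (IHs B') => //; rewrite -[combination s _](addrK (f * T)).
    apply: idealB => //; first by apply: BB'; apply: Bw.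
    exact: ideal_mulr.
  move: Bw; rewrite comb0 // add0r => /nzf/(IHM (fun k => w k.+1)) wS.
  by case=> [|k] lt_k e; [exact: w0|apply: wS].
rewrite /combination /= big_allpairs_dep /= => Bv _
  /allpairsPdep[k [e [kN eN ->]]].
apply: (step N (fun k e => v (k :: e))) => //; last first.
  by move: kN; rewrite mem_iota.
move: Bv; rewrite -[N in iota 0 N]subn0 -/(index_iota 0 N) big_mkord.
congr B; apply: eq_bigr => i _; rewrite mulr_sumr; apply: eq_bigr => e' _.
by rewrite scalerAr.
Qed.

End Independence.

Section DimensionBound.
Variables (K : fieldType) (n : nat).
Implicit Types (U : pred 'X_{1..n}) (c g : 'X_{1..n}) (p q : {mpoly K[n]}).
Implicit Types (s : seq {mpoly K[n]}).

Definition degree_le D p := forall c, c \in msupp p -> (mdeg c <= D)%N.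

Lemma degree_leM D E p q :
  degree_le D p -> degree_le E q -> degree_le (D + E) (p * q).
Proof.
move=> Dp Eq c /msuppM_le/allpairsP[[c1 c2] [/= /Dp Dc1 /Eq Ec2 ->]].
by rewrite mdegD leq_add.
Qed.

Lemma degree_le1 D : degree_le D 1.
Proof. by move=> c; rewrite msupp1 inE => /eqP->; rewrite mdeg0. Qed.

Lemma degree_leX D p k : degree_le D p -> degree_le (k * D) (p ^+ k).
Proof.
move=> Dp; elim: k => [|k IHk]; first exact: degree_le1.
by rewrite exprS; apply: degree_leM.
Qed.

Lemma degree_le_power_product D N s e :
    (forall f, f \in s -> degree_le D f) -> e \in exponents (size s) N ->
  degree_le (size s * (N * D)) (power_product s e).
Proof.
elim: s e => [|f s IHs] e /= sD; first by move=> _; apply: degree_le1.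
case/allpairsPdep => k [e' [kN eN ->]] /=; rewrite mulSn.
apply: degree_leM; last first.
  by apply: IHs => // h hs; apply: sD; rewrite inE hs orbT.
move=> c /(degree_leX (sD f (mem_head _ _))) /leq_trans; apply.
by rewrite leq_mul2r; move: kN; rewrite mem_iota => /ltnW ->; rewrite orbT.
Qed.

Definition saturated g c : {set 'I_n} := [set i | (g i <= c i)%N].

(** A monomial is determined by its truncation at [g] and by its exponents at
    the saturated variables. *)
Lemma card_outside U g d M :
    (forall c, ~~ U c -> (#|saturated g c| <= d)%N) ->
  (#|[set c : 'X_{1..n < M.+1} | ~~ U c]| <= (mdeg g).+1 ^ n * M.+1 ^ d)%N.
Proof.
move=> Ud.
pose code (c : 'X_{1..n < M.+1}) :
    {ffun 'I_n -> 'I_(mdeg g).+1} * {ffun 'I_d -> 'I_M.+1} :=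
  ([ffun i => inord (minn (c i) (g i))],
   [ffun k : 'I_d => inord (nth 0%N [seq c i | i <- enum (saturated g c)] k)]).
have le_mdeg (c : 'X_{1..n}) i : (c i <= mdeg c)%N.
  by rewrite mdegE (bigD1 i) //= leq_addr.
have code_inj : {in [set c : 'X_{1..n < M.+1} | ~~ U c] &, injective code}.
  move=> c c'; rewrite !inE => /Ud cd /Ud c'd [/ffunP e1 /ffunP e2].
  have {}e1 i : minn (c i) (g i) = minn (c' i) (g i).
    have := congr1 (@nat_of_ord _) (e1 i); rewrite !ffunE !inordK //.
      by rewrite ltnS geq_min le_mdeg orbT.
    by rewrite ltnS geq_min le_mdeg orbT.
  have eS : saturated g c = saturated g c'.
    by apply/setP => i; rewrite !inE; have := e1 i; lia.
  apply/val_inj/mnmP => i /=.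
  have [iS|] := boolP (i \in saturated g c); last first.
    move=> niS; have := niS; rewrite eS; move: niS; rewrite !inE.
    by have := e1 i; lia.
  have iE : i \in enum (saturated g c) by rewrite mem_enum.
  have id : (index i (enum (saturated g c)) < d)%N.
    by apply: leq_trans cd; rewrite cardE index_mem.
  have := congr1 (@nat_of_ord _) (e2 (Ordinal id)).
  rewrite !ffunE /= -eS !(nth_map i).
  - rewrite !nth_index // !inordK //.
      by apply: leq_ltn_trans (bmdeg c').
    by apply: leq_ltn_trans (bmdeg c).
  - by rewrite index_mem.
  - by rewrite index_mem.
rewrite -(card_in_imset code_inj); apply: leq_trans (max_card _) _.
by rewrite card_prod !card_ffun !card_ord.
Qed.

(** More than [d] elements have more power products of bounded degree than
    there are monomials outside [U], so some combination of them lies in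
    [monomial_ideal U]. *)
Lemma cancelling_size U g d B s :
    (forall c, ~~ U c -> (#|saturated g c| <= d)%N) ->
    is_ideal B -> included (@monomial_ideal K n U) B -> cancelling B s ->
  (size s <= d)%N.
Proof.
move=> Ud Bi UB sec; rewrite leqNgt; apply/negP => lt_ds.
have [D Ds] : exists D, forall f, f \in s -> degree_le D f.
  elim: (s) => [|f s' [D Ds']]; first by exists 0%N.
  exists (maxn D (msize f)) => h; rewrite inE => /orP[/eqP->|/Ds' Dh] c.
    by move=> /msize_mdeg_lt/ltnW; rewrite leq_max orbC => ->.
  by move=> /Dh; rewrite leq_max => ->.
set l := size s in lt_ds.
(* There are at most [C * N ^ d] monomials outside [U] of degree at most [M],
   which bounds the degrees of the power products with exponents below [N];
   the number of the latter is at least [N ^ d.+1]. *)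
pose C := ((mdeg g).+1 ^ n * (l * D).+1 ^ d)%N; pose N := C.+1.
pose M := (l * (N * D))%N; pose E := exponents l N.
pose outside := [seq val c | c : 'X_{1..n < M.+1} in
  [set c : 'X_{1..n < M.+1} | ~~ U c]].
have lt_size : (size outside < size E)%N.
  rewrite size_image size_exponents; apply: leq_ltn_trans (card_outside M Ud) _.
  have le_M : (M.+1 <= N * (l * D).+1)%N.
    by rewrite mulnS -addn1 addnC /M mulnCA leq_add2r.
  apply: (@leq_ltn_trans (C * N ^ d)).
    rewrite /C -mulnA leq_mul2l [(_ * N ^ d)%N]mulnC -expnMn.
    by case: (d) => [|d']; rewrite ?leqnn ?leq_exp2r ?le_M ?orbT.
  apply: (@leq_trans (N ^ d.+1)); last by rewrite leq_pexp2l.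
  by rewrite expnS ltn_mul2r expn_gt0 /= /N ltnS leqnn.
pose A := \matrix_(i < size E, j < size outside)
  (power_product s (nth [::] E i))@_(nth 0%MM outside j).
have /rowV0Pn[u /sub_kermxP uA nz_u] : kermx A != 0.
  rewrite kermx_eq0 /row_free; apply: contraL lt_size => /eqP <-.
  by rewrite -leqNgt rank_leq_col.
pose v e : K := if insub (index e E) is Some i then u 0 i else 0.
have uniqE : uniq E := uniq_exponents l N.
have v_nth (i : 'I_(size E)) : v (nth [::] E i) = u 0 i.
  by rewrite /v index_uniq // valK.
have vE : combination N s v =
    \sum_(i < size E) u 0 i *: power_product s (nth [::] E i).
  rewrite /combination -/l -/E (big_nth [::]) big_mkord.
  by apply: eq_bigr => i _; rewrite v_nth.
have Uv : monomial_ideal U (combination N s v).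
  apply/monomial_idealP => c nUc.
  have [le_cM|lt_Mc] := leqP (mdeg c) M; last first.
    apply: memN_msupp_eq0; rewrite /combination; apply: contraL lt_Mc.
    case/msupp_sum_le/flattenP => _ /mapP[e + ->] /msuppZ_le.
    rewrite -leqNgt filter_predT => eE.
    exact: degree_le_power_product.
  have c_out : c \in outside.
    apply/imageP; exists (BMultinom (le_cM : (mdeg c < M.+1)%N)) => //.
    by rewrite inE.
  have jP : (index c outside < size outside)%N by rewrite index_mem.
  have := congr1 (fun B : 'rV_(size outside) => B 0 (Ordinal jP)) uA.
  rewrite !mxE => <-; rewrite vE raddf_sum /=.
  by apply: eq_bigr => i _; rewrite mcoeffZ mxE /= nth_index.
have v0 := cancelling_independent Bi sec (UB _ Uv).
case/eqP: nz_u; apply/rowP => i; rewrite mxE -v_nth; apply: v0.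
exact: mem_nth.
Qed.

End DimensionBound.

(** * Face ideals and the Krull dimension *)

Section Faces.
Variables (K : fieldType) (n : nat).
Implicit Types (F : {set 'I_n}) (c b g : 'X_{1..n}) (p q : {mpoly K[n]}).

Definition off F : pred 'X_{1..n} :=
  fun c => [exists i, (i \notin F) && (0 < c i)%N].

(** The prime ideal generated by the variables outside [F]. *)
Definition face_ideal F : {mpoly K[n]} -> Prop := monomial_ideal (off F).

Lemma off_upward F : upward (off F).
Proof.
move=> c e /existsP[i /andP[iF ci]]; apply/existsP; exists i.
by rewrite iF mnmDE addn_gt0 ci.
Qed.

Lemma notoffP F c i : ~~ off F c -> i \notin F -> c i = 0%N.
Proof.
rewrite negb_exists => /forallP/(_ i); rewrite negb_and negbK.
by case/orP=> [->//|]; rewrite -eqn0Ngt => /eqP.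
Qed.

Lemma off_sub F F' c : F' \subset F -> off F c -> off F' c.
Proof.
move=> FF /existsP[i /andP[iF ci]]; apply/existsP; exists i.
by rewrite ci (contra (subsetP FF i)).
Qed.

Lemma off_var F i : off F U_(i)%MM = (i \notin F).
Proof.
apply/existsP/idP => [[k]|iF]; last by exists i; rewrite iF mnm1E eqxx.
by rewrite mnm1E lt0b => /andP[kF /eqP->].
Qed.

Lemma face_ideal_ideal F : is_ideal (face_ideal F).
Proof. exact/monomial_ideal_ideal/off_upward. Qed.

(** [face_ideal F] is the kernel of the substitution of [0] for the variables
    outside [F]. *)
Lemma face_ideal_prime F : is_prime_ideal (face_ideal F).
Proof.
pose kill p :=
  p \mPo [tuple (if i \in F then 'X_i else 0 : {mpoly K[n]}) | i < n].
have killX c : kill 'X_[c] = if off F c then 0 else 'X_[c].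
  rewrite /kill comp_mpolyX; case: ifPn => [/existsP[i /andP[iF ci]]|offc].
    rewrite (bigD1 i) //= tnth_mktuple (negPf iF) expr0n eqn0Ngt ci.
    by rewrite mul0r.
  rewrite [RHS]mpolyXE_id; apply: eq_bigr => i _; rewrite tnth_mktuple.
  by case: ifPn => // /(notoffP offc) ->; rewrite !expr0.
have killE p : face_ideal F p <-> kill p = 0.
  have kill_coef c : (kill p)@_c = if off F c then 0 else p@_c.
    rewrite /kill comp_mpolyEX raddf_sum /=.
    under eq_bigr => e _ do rewrite mcoeffZ -/(kill _) killX.
    case: ifPn => offc.
      apply: big1 => e _; case: ifPn => offe; first by rewrite mcoeff0 mulr0.
      rewrite mcoeffX; case: eqP => [ec|]; last by rewrite mulr0.
      by rewrite ec offc in offe.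
    rewrite [in RHS](mpolyE p) raddf_sum /=; apply: eq_bigr => e _.
    rewrite mcoeffZ; case: ifPn => // offe; rewrite mcoeff0 mcoeffX.
    by case: eqP => // ec; rewrite ec (negPf offc) in offe.
  rewrite /face_ideal monomial_idealP; split=> [p0|kp0 c offc].
    by apply/mpolyP => c; rewrite kill_coef mcoeff0; case: ifPn => // /p0.
  by have := kill_coef c; rewrite kp0 mcoeff0 (negPf offc).
split; first exact: face_ideal_ideal.
  rewrite /face_ideal monomial_ideal1 => /existsP[i].
  by rewrite mnm0E ltnn andbF.
move=> p q /killE; rewrite /kill rmorphM /= => /eqP.
by rewrite mulf_eq0 => /orP[]/eqP/killE; [left|right].
Qed.

Lemma face_ideal_chain F B : included B (face_ideal F) ->
  exists Q, is_prime_chain B #|F| Q.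
Proof.
move=> BF; pose G i : {set 'I_n} := [set x in drop i (enum F)].
have G0 : G 0%N = F by apply/setP => x; rewrite inE drop0 mem_enum.
have GS i : G i.+1 \subset G i.
  by apply/subsetP => x; rewrite !inE -add1n -drop_drop; apply: mem_drop.
have GF i : G i \subset F.
  by apply/subsetP => x; rewrite inE => /mem_drop; rewrite mem_enum.
exists (fun i => face_ideal (G i)); split=> i lt_i.
  split; first exact: face_ideal_prime.
  by move=> p /BF; apply: monomial_ideal_sub => c; apply: off_sub (GF i).
split; first by apply: monomial_ideal_sub => c; apply: off_sub (GS i).
have [x0 _] : exists x0 : 'I_n, True.
  by case: (enum F) (cardE F) lt_i => [->|x l _ _] //; exists x.
have lt_e : (i < size (enum F))%N by rewrite -cardE.
pose x := nth x0 (enum F) i.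
have Edrop : drop i (enum F) = x :: drop i.+1 (enum F) by apply: drop_nth.
move=> /(_ 'X_x); rewrite /face_ideal !monomial_idealX !off_var !inE Edrop.
rewrite inE eqxx /=; have := drop_uniq i (enum_uniq F).
by rewrite Edrop /= => /andP[-> _] /(_ isT).
Qed.

End Faces.

Section Truncation.
Variables (K : fieldType) (n : nat) (g : 'X_{1..n}).
Implicit Types (F : {set 'I_n}) (c b e : 'X_{1..n}) (U : pred 'X_{1..n}).

Definition truncate c := [multinom minn (c i) (g i) | i < n].

(** The monomial ideals whose minimal generators divide [x^g]. *)
Definition truncated U := upward U /\ forall c, U c -> U (truncate c).

Lemma truncate_le c : (truncate c <= c)%MM.
Proof. by apply/mnm_lepP => i; rewrite mnmE geq_minl. Qed.

Lemma truncate_leg c : (truncate c <= g)%MM.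
Proof. by apply/mnm_lepP => i; rewrite mnmE geq_minr. Qed.

Lemma truncate_id c : (c <= g)%MM -> truncate c = c.
Proof.
by move=> /mnm_lepP cg; apply/mnmP => i; rewrite mnmE; apply/minn_idPl.
Qed.

Lemma truncatedE U c : truncated U -> U (truncate c) = U c.
Proof.
case=> upU trU; apply/idP/idP; last exact: trU.
exact/upward_le/truncate_le.
Qed.

Lemma saturated_le b c : (b <= c)%MM -> saturated g b \subset saturated g c.
Proof.
move=> /mnm_lepP bc; apply/subsetP => i; rewrite !inE => /leq_trans; apply.
exact: bc.
Qed.

Lemma saturated_truncate c : saturated g (truncate c) = saturated g c.
Proof. by apply/setP => i; rewrite !inE mnmE leq_min leqnn andbT. Qed.

Lemma sub_face_ideal U c :
    truncated U -> ~~ U c ->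
  included (monomial_ideal U) (@face_ideal K n (saturated g c)).
Proof.
move=> [upU trU] nUc; apply: monomial_ideal_sub => e Ue.
apply: contraR nUc => offe.
apply: upward_le (trU _ Ue) => //; apply/mnm_lepP => i; rewrite mnmE.
have [|/(notoffP offe)->] := boolP (i \in saturated g c); last by rewrite min0n.
by rewrite inE => /(leq_trans (geq_minr _ _)).
Qed.

(** The chain of face ideals below the saturated set of [c] attains the bound
    given by counting monomials. *)
Lemma monomial_ideal_dim U d c :
    truncated U -> ~~ U c -> #|saturated g c| = d ->
    (forall e, ~~ U e -> (#|saturated g e| <= d)%N) ->
  is_dim (@monomial_ideal K n U) d.
Proof.
move=> trU nUc <- Ud; split; first exact/face_ideal_chain/sub_face_ideal.
move=> l [Q chQ]; have [s <- sec] := prime_chain_cancelling chQ.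
have [[Q0i _ _] UQ0] := chQ.1 0%N isT.
exact: cancelling_size Ud Q0i UQ0 sec.
Qed.

Lemma regular_size U d s :
    upward U -> (forall e, ~~ U e -> (#|saturated g e| <= d)%N) ->
    is_regular_seq (@monomial_ideal K n U) s ->
  (size s <= d)%N.
Proof.
move=> upU Ud; have Ui := @monomial_ideal_ideal K n U upU.
case/(is_regular_seqE _ Ui) => regs n1; apply: (cancelling_size Ud Ui) => //.
exact: regular_cancelling.
Qed.

(** A Stanley decomposition, as a filtration by ideals.  The monomials whose
    truncation is a given [b] span a shifted copy of the quotient by the
    face ideal of [saturated g b], and adding these pieces in the order of
    decreasing degree of [b] keeps all the intermediate spaces ideals. *)
Lemma regular_filtration U U' d s :
    truncated U -> truncated U' -> (forall c, U c -> U' c) ->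
    (forall c, U' c -> ~~ U c -> (d <= #|saturated g c|)%N) ->
    (forall F, (d <= #|F|)%N -> regular full (@face_ideal K n F) s) ->
  regular (@monomial_ideal K n U') (monomial_ideal U) s.
Proof.
move=> + trU'; move E: (#|[set b : 'X_{1..n < (mdeg g).+1} |
  [&& U' b, ~~ U b & (b <= g)%MM]]|) => k.
elim: k U E => [|k IHk] U E trU UU' Ud regF.
  apply: regular_trivial; first exact/monomial_ideal_ideal/trU'.1.
  apply: monomial_ideal_sub => c U'c; rewrite -(truncatedE c trU).
  apply/negPn/negP => nUc; have /eqP := E; rewrite cards_eq0 => /eqP/setP.
  have lt_c : (mdeg (truncate c) < (mdeg g).+1)%N.
    rewrite ltnS !mdegE; apply: leq_sum => i _.
    exact: (mnm_lepP (truncate_leg c)).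
  move=> /(_ (BMultinom lt_c)); rewrite !inE /= truncatedE // U'c nUc.
  by rewrite truncate_leg.
set T := [set _ | _] in E.
have /set0Pn[b0 b0T] : T != set0 by rewrite -cards_eq0 E.
pose deg (b : 'X_{1..n < (mdeg g).+1}) := mdeg b.
case: (@arg_maxnP _ b0 (mem T) deg b0T) => b bT bmax.
have {}bT : b \in T := bT.
have := bT; rewrite inE => /and3P[U'b nUb le_bg].
have big_in c : U' c -> (b <= truncate c)%MM -> truncate c != b -> U c.
  move=> U'c le_bc ne_bc; rewrite -(truncatedE c trU).
  have lt_bc : (mdeg b < mdeg (truncate c))%N.
    rewrite ltnNge; apply: contra ne_bc => le_cb; rewrite -(submK le_bc).
    have : mdeg (truncate c - b) == 0%N.
      by move: le_cb; rewrite -{1}(submK le_bc) mdegD; lia.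
    by rewrite mdeg_eq0 => /eqP->; rewrite add0m.
  have lt_c : (mdeg (truncate c) < (mdeg g).+1)%N.
    rewrite ltnS !mdegE; apply: leq_sum => i _.
    exact: (mnm_lepP (truncate_leg c)).
  apply/negPn/negP => nUc; have /= := bmax (BMultinom lt_c).
  rewrite inE /= truncatedE // U'c nUc truncate_leg => /(_ isT).
  by rewrite leqNgt lt_bc.
pose U1 c := U c || (truncate c == b :> 'X_{1..n}).
have mono_tr c e : (truncate c <= truncate (c + e))%MM.
  by apply/mnm_lepP => i; rewrite !mnmE leq_min geq_minr geq_min leq_addr.
have trU1 : truncated U1.
  split=> [c e /orP[Uc|/eqP Ec]|c /orP[Uc|/eqP Ec]].
  - by rewrite /U1 trU.1.
  - rewrite /U1; have [|ne] := eqVneq (truncate (c + e)%MM) b.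
      by rewrite orbT.
    rewrite big_in //; last by rewrite -Ec.
    apply: trU'.1; apply: upward_le U'b; first exact: trU'.1.
    by rewrite -Ec truncate_le.
  - by rewrite /U1 trU.2.
  by rewrite /U1 (truncate_id (truncate_leg c)) Ec eqxx orbT.
have UU1 c : U c -> U1 c by rewrite /U1 => ->.
have U1U' c : U1 c -> U' c.
  move=> /orP[/UU'//|/eqP Ec]; apply: upward_le U'b; first exact: trU'.1.
  by rewrite -Ec truncate_le.
have Ui V : truncated V -> is_ideal (@monomial_ideal K n V).
  by case=> upV _; apply: monomial_ideal_ideal.
apply: (@regular_extension _ _ _ (monomial_ideal U1)); try exact: Ui.
- exact: monomial_ideal_sub.
- exact: monomial_ideal_sub.
- have U1b : U1 b by rewrite /U1 truncate_id // eqxx orbT.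
  have key c : U (b + c)%MM <-> off (saturated g b) c.
    split=> [Ubc|/existsP[i /andP[]]].
      apply: contraT => offc; rewrite -(truncatedE _ trU) in Ubc.
      case/negP: nUb; apply: upward_le Ubc; first exact: trU.1.
      apply/mnm_lepP => i; rewrite mnmE mnmDE.
      have [|/(notoffP offc)->] := boolP (i \in saturated g b).
        by rewrite inE => /(leq_trans (geq_minr _ _)).
      by rewrite addn0 geq_minl.
    rewrite inE -ltnNge => lt_bg ci; apply: big_in; first exact: trU'.1.
      by rewrite -{1}(truncate_id le_bg) mono_tr.
    apply/eqP => /(congr1 (fun c : 'X_{1..n} => c i)); rewrite mnmE mnmDE; lia.
  have := @regular_iso _ full (@face_ideal K n (saturated g b)) _ _ 'X_[b].
  apply=> //.
  + exact: face_ideal_ideal.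
  + exact: Ui.
  + exact: Ui.
  + move=> u U1u; exists (\sum_(c <- msupp u | truncate c == b :> 'X_{1..n})
        u@_c *: 'X_[c - b]) => //.
    rewrite {1}[u]mpolyE (bigID (fun c => truncate c == b :> 'X_{1..n})) /=.
    rewrite mulr_sumr.
    rewrite [X in _ - X](eq_bigr (fun c => u@_c *: 'X_[c])); last first.
      move=> c /eqP Ec; rewrite -scalerAr -mpolyXD addmC submK //.
      by rewrite -Ec truncate_le.
    rewrite addrAC subrr add0r big_seq_cond; apply: ideal_sum; first exact: Ui.
    move=> c /andP[/U1u/orP[Uc|->//] _]; rewrite -mul_mpolyC.
    by apply: (idealM _ (Ui _ trU)); apply/monomial_idealX.
  + by move=> h _; apply: (ideal_mulr _ (Ui _ trU1)); apply/monomial_idealX.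
  + move=> h _; rewrite mulrC /face_ideal; split=> Uh c ch.
      apply/key; apply: Uh; rewrite (perm_mem (msuppMX _ _)).
      exact: map_f.
    by move: ch; rewrite (perm_mem (msuppMX _ _)) => /mapP[e /Uh/key ? ->].
  + exact/regF/Ud.
apply: IHk => // [|c U'c]; last first.
  by rewrite negb_or => /andP[nUc _]; apply: Ud.
apply/eqP; rewrite -eqSS -E (cardsD1 b T) bT eqSS; apply/eqP.
congr #|pred_of_set _|.
apply/setP => c; rewrite !inE negb_or.
have [le_cg|] := boolP (c <= g)%MM; last by rewrite !andbF.
by rewrite truncate_id // -bmeqP -!andbA; case: (c == b); rewrite /= ?andbF.
Qed.

End Truncation.

(** * Homogeneous ideals and permutation of regular sequences *)

Section Homogeneous.
Variables (K : fieldType) (n : nat).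
Implicit Types (B : {mpoly K[n]} -> Prop) (p f u a : {mpoly K[n]}).
Implicit Types (s : seq {mpoly K[n]}) (F : {set 'I_n}).

Definition homogeneous_ideal B := forall p e, B p -> B (pihomog mdeg e p).

Definition homogeneous f := exists d, f \is d.-homog.

Lemma pihomog_mull f d e a : f \is d.-homog ->
  exists a', pihomog mdeg e (f * a) = f * a'.
Proof.
move=> homf; rewrite [a](pihomog_partitionE (mf := mdeg) (leqnn (msize a))).
rewrite mulr_sumr raddf_sum /=.
elim/big_ind: _ => [|_ _ [x ->] [y ->]|k _]; first by exists 0; rewrite mulr0.
  by exists (x + y); rewrite mulrDr.
have homk : f * pihomog mdeg k a \is (d + k).-homog.
  by apply: dhomogM => //; apply: pihomogP.
have [E|ne] := eqVneq (d + k)%N e.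
  by exists (pihomog mdeg k a); rewrite pihomog_dE // -E.
by exists 0; rewrite (pihomog_ne0 ne homk) mulr0.
Qed.

Lemma homogeneous_addmul B f :
  homogeneous f -> homogeneous_ideal B -> homogeneous_ideal (addmul full B f).
Proof.
move=> [d homf] homB _ e [b [a [Bb _ ->]]]; rewrite pihomogD.
have [a' ->] := pihomog_mull e a homf.
by exists (pihomog mdeg e b), a'; split=> //; apply: homB.
Qed.

Lemma homogeneous_face_ideal F : homogeneous_ideal (@face_ideal K n F).
Proof.
move=> p e Fp; rewrite pihomogE big_seq_cond.
have Fi := @face_ideal_ideal K n F.
apply: ideal_sum => // c /andP[/Fp offc _]; rewrite -mul_mpolyC.
by apply: (idealM _ Fi); apply/monomial_idealX.
Qed.

(** Krull's intersection theorem, which is a matter of degrees for a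
    homogeneous ideal. *)
Lemma homogeneous_separated B i u : is_ideal B -> homogeneous_ideal B ->
  (forall k, exists a, B (u - 'X_i ^+ k * a)) -> B u.
Proof.
move=> Bi homB sep.
rewrite [u](pihomog_partitionE (mf := mdeg) (leqnn (msize u))).
apply: ideal_sum => // e _; have [a] := sep e.+1.
move=> /(homB _ e); rewrite pihomogB.
suff -> : pihomog mdeg e ('X_i ^+ e.+1 * a) = 0 by rewrite subr0.
rewrite pihomogE; apply: big1_seq => c /andP[/eqP Ec].
rewrite mpolyXn mulrC (perm_mem (msuppMX _ _)) => /mapP[c' _ cE].
have : mdeg c = e by exact: Ec.
by rewrite cE mdegD mdegMn mdeg1; lia.
Qed.

(** A variable at the head of a homogeneous regular sequence can be moved to
    its end.  If [f] kills [u] modulo [B], then [u] is a multiple of the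
    variable modulo [B], and [f] kills the cofactor as well; so [u] is divisible
    by all the powers of the variable, and [homogeneous_separated] applies. *)
Lemma regular_swap B i s :
    is_ideal B -> homogeneous_ideal B -> (forall f, f \in s -> homogeneous f) ->
    nonzerodivisor full B 'X_i -> regular full (addmul full B 'X_i) s ->
  regular full B s /\ nonzerodivisor full (addmuls full B s) 'X_i.
Proof.
elim: s B => //= f s IHs B Bi homB homs nzX [nzf regs].
have subX : included B (addmul full B 'X_i) by apply: addmul_subl.
have nzBf : nonzerodivisor full B f.
  have step u : B (f * u) -> exists2 a, B (u - 'X_i * a) & B (f * a).
    move=> Bfu; have [b [a [Bb _ uE]]] := nzf u I (subX _ Bfu).
    exists a; first by rewrite uE addrK.
    apply: nzX => //.
    have -> : 'X_i * (f * a) = f * u - f * b by rewrite uE; ring.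
    by apply: idealB => //; apply: idealM.
  move=> u _ Bfu; apply: (homogeneous_separated (i := i)) => // k.
  suff [a ? _] : exists2 a, B (u - 'X_i ^+ k * a) & B (f * a) by exists a.
  elim: k => [|k [a Ba Bfa]].
    by exists u; rewrite // mul1r subrr; apply: ideal0.
  have [a' Ba' Bfa'] := step a Bfa; exists a' => //.
  have -> : u - 'X_i ^+ k.+1 * a' =
      (u - 'X_i ^+ k * a) + 'X_i ^+ k * (a - 'X_i * a') by rewrite exprSr; ring.
  by apply: idealD => //; apply: idealM.
have nzBX : nonzerodivisor full (addmul full B f) 'X_i.
  move=> u _ [b [v [Bb _ Xu]]].
  have [|b' [v' [Bb' _ vE]]] := nzf v I.
    exists (- b), u; split=> //; first exact: idealN.
    by rewrite Xu addKr.
  exists (u - f * v'), v'; split=> //; last by rewrite subrK.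
  apply: nzX => //.
  have -> : 'X_i * (u - f * v') = b + f * b' by rewrite mulrBr Xu vE; ring.
  by apply: idealD => //; apply: idealM.
have homf : homogeneous f by apply: homs; rewrite mem_head.
have Bfi := addmul_ideal f full_ideal Bi.
have [||//||? ?] := IHs (addmul full B f) Bfi; last by split.
- exact: homogeneous_addmul.
- by move=> h hs; apply: homs; rewrite inE hs orbT.
- by rewrite addmulC.
Qed.

End Homogeneous.

(** * Universal parameters *)

Section ElementarySymmetric.
Variables (K : fieldType) (n D : nat).
Implicit Types (F h : {set 'I_n}) (c g : 'X_{1..n}).

(** The elementary symmetric polynomials in the [D]-th powers of the
    variables. *)
Definition theta k : {mpoly K[n]} :=
  \sum_(h : {set 'I_n} | #|h| == k) \prod_(i in h) 'X_i ^+ D.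

Definition thetas k := [seq theta j | j <- iota 1 k].

Lemma size_thetas k : size (thetas k) = k.
Proof. by rewrite size_map size_iota. Qed.

Lemma thetasS k : thetas k.+1 = rcons (thetas k) (theta k.+1).
Proof. by rewrite /thetas -(addn1 k) iotaD map_cat cats1 add1n addn1. Qed.

Definition power_monomial h := [multinom ((i \in h) * D)%N | i < n].

Lemma power_monomialE h :
  \prod_(i in h) 'X_i ^+ D = 'X_[power_monomial h] :> {mpoly K[n]}.
Proof.
rewrite mpolyXE_id big_mkcond; apply: eq_bigr => i _; rewrite mnmE.
by case: (i \in h); rewrite ?mul1n ?mul0n.
Qed.

Lemma theta_homogeneous k : homogeneous (theta k).
Proof.
exists (k * D)%N; apply: rpred_sum => h /eqP <-.
rewrite power_monomialE dhomogX; apply/eqP; apply: etrans (mdegE _) _.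
under eq_bigr => i _ do rewrite mnmE.
rewrite -big_distrl /= -sum1_card [in RHS]big_mkcond.
by congr (_ * _)%N; apply: eq_bigr => i _; case: (i \in h).
Qed.

Variable D_gt0 : (0 < D)%N.

Lemma off_power_monomial F h : off F (power_monomial h) = ~~ (h \subset F).
Proof.
apply/existsP/subsetPn => [[i]|[i ih iF]]; last first.
  by exists i; rewrite iF mnmE ih mul1n.
rewrite mnmE => /andP[iF]; case ih: (i \in h); last by rewrite mul0n.
by move=> _; exists i.
Qed.

Lemma theta0 : theta 0 = 1.
Proof.
rewrite /theta (big_pred1 set0) ?big_set0 // => h.
by rewrite cards_eq0.
Qed.

Lemma theta_in_max_ideal k : (0 < k)%N -> max_ideal K n (theta k).
Proof.
move=> k_gt0; have mi : is_ideal (max_ideal K n) by apply: ideal_gen_ideal.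
apply: ideal_sum => // h /eqP hk.
have /card_gt0P[i ih] : (0 < #|h|)%N by rewrite hk.
rewrite (bigD1 i) //= -(prednK D_gt0) exprS -mulrA.
by apply: (ideal_mulr _ mi); apply: ideal_gen_sub; exists i.
Qed.

Lemma face_ideal_addmul F i : i \in F ->
  addmul full (@face_ideal K n F) 'X_i = face_ideal (F :\ i).
Proof.
move=> iF; apply: pred_ext => p.
have Fi := @face_ideal_ideal K n (F :\ i); have Fi' := @face_ideal_ideal K n F.
have Xi : @face_ideal K n (F :\ i) 'X_i.
  by apply/monomial_idealX; rewrite off_var !inE eqxx.
split=> [[b [a [Fb _ ->]]]|Fp].
  apply: (idealD Fi); last exact: (ideal_mulr _ Fi).
  by apply: monomial_ideal_sub Fb => c; apply: off_sub; apply: subD1set.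
rewrite [p]mpolyE big_seq.
have Ai := addmul_ideal ('X_i : {mpoly K[n]}) full_ideal Fi'.
apply: (ideal_sum _ Ai) => c /Fp /existsP[k]; rewrite !inE negb_and negbK.
rewrite -mul_mpolyC => /andP[kF ck]; apply: (idealM _ Ai).
have [Ek|ne_ki] := eqVneq k i.
  have le_ic : (U_(i) <= c)%MM by rewrite lep1mP -Ek -lt0n.
  rewrite -(submK le_ic) addmC mpolyXD.
  exact: addmul_mul.
apply: addmul_subl => //; apply/monomial_idealX/existsP; exists k.
by rewrite ck andbT; move: kF; rewrite (negPf ne_ki).
Qed.

(** Induction on the dimension.  Modulo a variable [x_f] with [f] in [F] the
    claim holds by induction, and permuting [x_f] to the end gives both the
    regularity of the first parameters modulo [face_ideal F] and that [x_f] is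
    a nonzerodivisor modulo them.  The last parameter is a product of powers of
    such variables. *)
Lemma thetas_regular_face F k :
  (k <= #|F|)%N -> regular full (@face_ideal K n F) (thetas k).
Proof.
move: {2}#|F| (leqnn #|F|) => m; elim: m F k => [|m IHm] F k.
  by rewrite leqn0 => /eqP->; rewrite leqn0 => /eqP->.
have swap i l : (#|F| <= m.+1)%N -> i \in F -> (l < #|F|)%N ->
    regular full (@face_ideal K n F) (thetas l) /\
    nonzerodivisor full (addmuls full (@face_ideal K n F) (thetas l)) 'X_i.
  move=> le_Fm iF lt_l; apply: regular_swap.
  - exact: face_ideal_ideal.
  - exact: homogeneous_face_ideal.
  - by move=> f /mapP[j _ ->]; apply: theta_homogeneous.
  - have [_ _ prF] := @face_ideal_prime K n F => u _ /prF[|//].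
    by rewrite /face_ideal monomial_idealX off_var iF.
  rewrite face_ideal_addmul //; move: le_Fm lt_l.
  by rewrite (cardsD1 i F) iF !ltnS => ? ?; apply: IHm.
move=> le_Fm; case: k => [//|k] lt_k.
have /card_gt0P[i iF] : (0 < #|F|)%N by apply: leq_ltn_trans lt_k.
rewrite thetasS; apply/regular_rcons; split.
  by have [] := swap i k le_Fm iF lt_k.
have [lt_kF|le_Fk] := ltnP k.+1 #|F|.
  have := (swap i k.+1 le_Fm iF lt_kF).1.
  by rewrite thetasS => /regular_rcons[].
have Fk : #|F| = k.+1 by apply/eqP; rewrite eqn_leq le_Fk.
set J := addmuls _ _ _.
have Fi := @face_ideal_ideal K n F.
have Ji : is_ideal J by apply: addmuls_ideal.
have nzprod : nonzerodivisor full J (\prod_(i in F) 'X_i ^+ D).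
  elim/big_ind: _ => [|f h|j jF].
  - exact: nonzerodivisor1.
  - exact: nonzerodivisorM.
  elim: (D) => [|e IHe]; first exact: nonzerodivisor1.
  rewrite exprS; apply: nonzerodivisorM => //.
  by have [] := swap j k le_Fm jF lt_k.
move=> u _ Ju; apply: nzprod => //.
have J_rest : J (theta k.+1 - \prod_(i in F) 'X_i ^+ D).
  rewrite /theta (bigD1 F) ?Fk //= addrAC subrr add0r.
  apply: ideal_sum => // h /andP[/eqP hk ne_hF]; apply: addmuls_subl => //.
  rewrite power_monomialE; apply/monomial_idealX; rewrite off_power_monomial.
  by apply: contra ne_hF => hF; rewrite eqEcard hF Fk hk leqnn.
have -> : \prod_(i in F) 'X_i ^+ D * u =
    theta k.+1 * u - (theta k.+1 - \prod_(i in F) 'X_i ^+ D) * u by ring.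
by apply: idealB => //; apply: ideal_mulr.
Qed.

(** Evaluating [\prod_k (T - x_k ^ D)] at [T = x_i ^ D] expresses a power of
    [x_i] by the [theta k].  The ones with [k > j] lie in the ideal. *)
Lemma thetas_primary U g j i :
    truncated g U -> (forall k, g k <= D)%N ->
    (forall c, (j < #|saturated g c|)%N -> U c) ->
  addmuls full (monomial_ideal U) (thetas j) ('X_i ^+ (D * n)).
Proof.
move=> [upU trU] gD Uj.
have Ui := @monomial_ideal_ideal K n U upU.
have Ji : is_ideal (addmuls full (@monomial_ideal K n U) (thetas j)).
  exact: addmuls_ideal.
set J := addmuls _ _ _ in Ji *.
pose y k : {mpoly K[n]} := 'X_k ^+ D.
have thetaJ k : (0 < k)%N -> J (theta k).
  move=> k_gt0; have [le_kj|lt_jk] := leqP k j.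
    apply: addmuls_mem => //; apply/mapP; exists k => //.
    by rewrite mem_iota k_gt0 add1n ltnS.
  apply: addmuls_subl => //; apply: ideal_sum => // h /eqP hk.
  rewrite power_monomialE; apply/monomial_idealX/Uj.
  apply: leq_trans lt_jk _; rewrite -hk.
  apply/subset_leq_card/subsetP => k' k'h.
  by rewrite inE mnmE k'h mul1n.
have prod0 : \prod_k (- y k + y i) = 0.
  by rewrite (bigD1 i) //= addNr mul0r.
have prodE : \prod_k (- y k + y i) =
    \sum_(k < n.+1) (-1) ^+ k * y i ^+ (n - k) * theta k.
  pose size_of (h : {set 'I_n}) : 'I_n.+1 := inord #|h|.
  rewrite bigA_distr /= (partition_big size_of predT) //=.
  apply: eq_bigr => k _; rewrite mulr_sumr; apply: eq_big => h.
    rewrite -val_eqE /= inordK // ltnS; apply: leq_trans (max_card _) _.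
    by rewrite card_ord.
  move=> /eqP hk; have {}hk : #|h| = k.
    have /(congr1 val) := hk; rewrite /= inordK //.
    by rewrite ltnS -[leqRHS]card_ord max_card.
  rewrite big_if /= prodrN prodr_const hk mulrAC; congr (_ * _ * _).
  congr (_ ^+ _); rewrite -hk -[n in (n - _)%N]card_ord.
  by rewrite -(cardC (mem h)) addKn.
rewrite exprM -/(y i).
have -> : y i ^+ n =
    - \sum_(k < n) (-1) ^+ k.+1 * y i ^+ (n - k.+1) * theta k.+1.
  apply/eqP; rewrite -addr_eq0 -[X in _ == X]prod0 prodE big_ord_recl /=.
  by rewrite theta0 expr0 mul1r mulr1 subn0.
apply: idealN => //; apply: ideal_sum => // k _; apply: idealM => //.
exact: thetaJ.
Qed.

End ElementarySymmetric.

(** * Depth of a monomial quotient and of its skeletons *)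

Lemma bounded_is_max (P : nat -> Prop) d k :
  P k -> (forall l, P l -> (l <= d)%N) -> exists t, is_max P t.
Proof.
move=> Pk; elim: d => [|d IHd] le_P.
  have k0 : k = 0%N by apply/eqP; rewrite -leqn0 le_P.
  by exists k; split=> // l; rewrite k0; apply: le_P.
have [PdS|nPdS] := classic (P d.+1); first by exists d.+1.
apply: IHd => l Pl; rewrite -ltnS ltn_neqAle le_P // andbT.
by apply/eqP => lE; rewrite -lE in nPdS.
Qed.

Lemma is_max_unique (P : nat -> Prop) k l : is_max P k -> is_max P l -> k = l.
Proof.
by move=> [Pk maxk] [Pl maxl]; apply/eqP; rewrite eqn_leq maxl ?maxk.
Qed.

Section Skeletons.
Variables (K : fieldType) (n : nat) (g : 'X_{1..n}).
Implicit Types (U : pred 'X_{1..n}) (c b e : 'X_{1..n}) (p u : {mpoly K[n]}).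

Let D := (mdeg g).+1.
Let ths := thetas K n D.
Let ideal_of U := @monomial_ideal K n U.

Definition variables := [seq 'X_i : {mpoly K[n]} | i <- enum 'I_n].

Lemma max_idealE : max_ideal K n = ideal_gen (fun p => p \in variables).
Proof.
have E : (fun p : {mpoly K[n]} => exists i, p = 'X_i) =
    fun p => p \in variables.
  apply: pred_ext => p; split=> [[i ->]|/mapP[i _ ->]]; last by exists i.
  by apply: map_f; rewrite mem_enum.
by rewrite /max_ideal E.
Qed.

Lemma max_ideal_sub_face : included (max_ideal K n) (@face_ideal K n set0).
Proof.
move=> p; apply; first exact: face_ideal_ideal.
by move=> _ [i ->]; apply/monomial_idealX; rewrite off_var inE.
Qed.

(** The monomials of [I_j], when [U] is the set of those of [I]. *)
Definition skeleton U j : pred 'X_{1..n} :=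
  fun c => U c || (j < #|saturated g c|)%N.

Lemma skeleton_truncated U j : truncated g U -> truncated g (skeleton U j).
Proof.
rewrite /skeleton; move=> [upU trU].
split=> [c e /orP[Uc|lt_j]|c /orP[Uc|lt_j]].
- by rewrite upU.
- rewrite (leq_trans lt_j) ?orbT //; apply/subset_leq_card/saturated_le.
  exact: lem_addr.
- by rewrite trU.
by rewrite saturated_truncate lt_j orbT.
Qed.

Lemma skeleton_idealE U j : truncated g U ->
  skeleton_ideal g (ideal_of U) j = ideal_of (skeleton U j).
Proof.
move=> trU; have Ui := @monomial_ideal_ideal K n _ (skeleton_truncated j trU).1.
have Si := ideal_gen_ideal (fun p : {mpoly K[n]} =>
  ideal_of U p \/ exists2 b, (j < rho g b)%N & p = 'X_[b]).
apply: pred_ext => p; split.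
  apply; [exact: Ui|move=> q [Uq|[b lt_j ->]]].
    by apply: monomial_ideal_sub Uq => c Uc; rewrite /skeleton Uc.
  apply/monomial_idealX; rewrite /skeleton (leq_trans lt_j) ?orbT //.
  by apply/subset_leq_card/subsetP => i; rewrite !inE => /eqP->.
move=> Sp; rewrite [p]mpolyE big_seq; apply: (ideal_sum _ Si) => c /Sp Sc.
rewrite -mul_mpolyC; apply: (idealM _ Si); case/orP: Sc => [Uc|lt_j].
  by apply: ideal_gen_sub; left; apply/monomial_idealX.
rewrite -(submK (truncate_le g c)) mpolyXD; apply: (idealM _ Si).
apply: ideal_gen_sub; right; exists (truncate g c) => //.
apply: leq_trans lt_j _; apply/subset_leq_card/subsetP => i.
by rewrite !inE mnmE => /minn_idPr ->.
Qed.

(** The kernel [I_j/I] of [S/I -> S/I_j] has depth above [j], so the vanishing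
    of cohomology below [j] passes from [S/I] to [S/I_j], and the regularity of
    [j] parameters passes from [S/I_j] to [S/I]. *)
Lemma skeleton_kernel_regular U j k : truncated g U -> (k <= j.+1)%N ->
  regular (ideal_of (skeleton U j)) (ideal_of U) (ths k).
Proof.
move=> trU le_kj; apply: (@regular_filtration K n g U _ k) => //.
- exact: skeleton_truncated.
- by move=> c Uc; rewrite /skeleton Uc.
- by move=> c /orP[->//|lt_j] _; apply: leq_trans lt_j.
- by move=> F; apply: thetas_regular_face.
Qed.

Lemma ths_max_ideal k f : f \in ths k -> max_ideal K n f.
Proof.
move=> /mapP[j]; rewrite mem_iota => /andP[j_gt0 _] ->.
exact: theta_in_max_ideal.
Qed.

Lemma sub_skeleton U j : included (ideal_of U) (ideal_of (skeleton U j)).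
Proof. by apply: monomial_ideal_sub => c Uc; rewrite /skeleton Uc. Qed.

Lemma skeleton_vanishes U j q : truncated g U -> (q <= j)%N ->
    vanishes variables q full (ideal_of U) ->
  vanishes variables q full (ideal_of (skeleton U j)).
Proof.
move=> trU le_qj V; have trS := skeleton_truncated j trU.
have Ui := @monomial_ideal_ideal K n _ trU.1.
have Si := @monomial_ideal_ideal K n _ trS.1.
apply: (vanishes_subquotient full_ideal Ui Si _ _ V) => //.
  exact: sub_skeleton.
apply: (regular_vanishes (s := ths j.+1)) => //; first exact: sub_skeleton.
- by move=> f /ths_max_ideal; rewrite max_idealE.
- exact: skeleton_kernel_regular.
by rewrite size_thetas.
Qed.

(** If the socle modulo [J] is zero and a power of each variable kills [u]
    modulo [J], then all the monomials of large degree kill [u], and the degree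
    bound can be lowered one step at a time. *)
Lemma socle_saturated (J : {mpoly K[n]} -> Prop) N u : is_ideal J ->
    (forall v, (forall i, J ('X_i * v)) -> J v) ->
    (forall i, J ('X_i ^+ N * u)) ->
  J u.
Proof.
move=> Ji socle Ju.
have low k c : (n * N < mdeg c + k)%N -> J ('X_[c] * u).
  elim: k c => [|k IHk] c.
    rewrite addn0 mdegE => lt_c.
    have [i le_N] : exists i, (N <= c i)%N.
      apply/existsP; apply: contraTT lt_c => /existsPn c_small.
      rewrite -leqNgt -[n in (n * N)%N]card_ord -sum_nat_const.
      by apply: leq_sum => i _; rewrite ltnW // ltnNge.
    have le_c : (U_(i) *+ N <= c)%MM.
      apply/mnm_lepP => l; rewrite mulmnE mnm1E.
      by case: eqP => [<-|_]; rewrite ?mul1n.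
    by rewrite -(submK le_c) mpolyXD -mpolyXn -mulrA; apply: idealM.
  move=> lt_c; apply: socle => i; rewrite mulrA -mpolyXD; apply: IHk.
  by rewrite mdegD mdeg1 add1n addSnnS.
by have := low (n * N).+1 0%MM; rewrite mdeg0 add0n mpolyX0 mul1r; apply.
Qed.

(** In the induction step, the first [j] parameters are regular on the
    [j]-skeleton by the induction hypothesis, hence on the whole quotient.
    Modulo these the socle is still zero, by the vanishing.  An element that the
    last parameter kills is killed by a power of each variable, because the
    dimension is at most [j + 1], and is therefore zero. *)
Lemma vanishes_thetas_regular U j : truncated g U ->
    (forall c, (j < #|saturated g c|)%N -> U c) ->
    (forall q, (q <= j)%N -> vanishes variables q full (ideal_of U)) ->
  regular full (ideal_of U) (ths j).
Proof.
elim: j U => [|j IHj] U trU Uj V //.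
have trS := skeleton_truncated j trU.
have Ui := @monomial_ideal_ideal K n _ trU.1.
have Si := @monomial_ideal_ideal K n _ trS.1.
have regj : regular full (ideal_of U) (ths j).
  apply: (regular_extension full_ideal Ui Si) => //; first exact: sub_skeleton.
    exact: skeleton_kernel_regular.
  apply: IHj => // [c lt_j|q le_qj]; first by rewrite /skeleton lt_j orbT.
  by apply: skeleton_vanishes => //; apply/V/leqW.
rewrite /ths thetasS; apply/regular_rcons; split=> // u _.
set J := addmuls _ _ _ => Ju; have Ji : is_ideal J by apply: addmuls_ideal.
apply: (socle_saturated (N := (D * n)%N)) => // [v socle_v|i].
  apply: (@vanishes1_socle _ variables) => // [|x /mapP[i _ ->]]; last first.
    exact: socle_v.
  apply: (@vanishes_quotient_seq _ _ _ _ _ 1) => // q.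
  by rewrite size_thetas; apply: V.
have := @thetas_primary K n D U g j.+1 i trU _ Uj.
have le_D k : (g k <= D)%N by rewrite /D mdegE (bigD1 k) //= leqW // leq_addr.
move=> /(_ le_D); rewrite thetasS /addmuls foldl_rcons => -[b [a [Jb _ ->]]].
have -> : (b + theta K n D j.+1 * a) * u = b * u + a * (theta K n D j.+1 * u).
  by ring.
by apply: idealD => //; [apply: ideal_mulr|apply: idealM].
Qed.

Definition depth_length U l := exists s : seq {mpoly K[n]},
  [/\ size s = l, forall x, x \in s -> max_ideal K n x &
      is_regular_seq (ideal_of U) s].

Lemma depth_length_vanishes U l q : truncated g U -> depth_length U l ->
  (q <= l)%N -> vanishes variables q full (ideal_of U).
Proof.
move=> trU [s [<- sm]]; have Ui := @monomial_ideal_ideal K n _ trU.1.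
case/(is_regular_seqE _ Ui) => regs _; apply: regular_vanishes => // f /sm.
by rewrite max_idealE.
Qed.

Lemma thetas_depth_length U k : truncated g U -> ~~ U 0%MM ->
  regular full (ideal_of U) (ths k) -> depth_length U k.
Proof.
move=> trU nU0 regk; have Ui := @monomial_ideal_ideal K n _ trU.1.
exists (ths k); split; [exact: size_thetas|exact: ths_max_ideal|].
apply/is_regular_seqE => //; split=> // th1.
have [Fi nF1 _] := @face_ideal_prime K n set0; apply: nF1.
apply: (addmuls_min Fi _ _ th1) => [|f /ths_max_ideal/max_ideal_sub_face//].
apply: monomial_ideal_sub => c Uc; apply: contraR nU0 => offc.
suff -> : 0%MM = c by [].
by apply/mnmP => i; rewrite mnm0E (notoffP offc) ?inE.
Qed.

Lemma depth_length_outside U l : truncated g U -> depth_length U l -> ~~ U 0%MM.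
Proof.
move=> trU [s [_ _]]; have Ui := @monomial_ideal_ideal K n _ trU.1.
case/(is_regular_seqE _ Ui) => _ n1; apply/negP => /monomial_ideal1 U1.
by apply: n1; apply: addmuls_subl.
Qed.

(** Setting exponents of saturated variables to zero lowers the number of
    saturated variables by one at a time. *)
Lemma saturated_level U j c : truncated g U -> ~~ U c ->
    (#|saturated g 0%MM| <= j <= #|saturated g c|)%N ->
  exists2 b, ~~ U b & #|saturated g b| = j.
Proof.
move=> trU; move E: (#|saturated g c| - j)%N => k.
elim: k c E => [|k IHk] c E nUc /andP[le_0j le_jc].
  by exists c => //; lia.
have [i] : exists i, i \in saturated g c :\: saturated g 0%MM.
  apply/set0Pn; rewrite setD_eq0; apply/negP => /subset_leq_card; lia.
rewrite !inE mnm0E -ltnNge => /andP[gi_gt0 gi_le].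
pose b := [multinom if l == i then 0%N else c l | l < n].
have satb : saturated g b = saturated g c :\ i.
  apply/setP => l; rewrite !inE mnmE; case: eqP => [->|//].
  by rewrite leqNgt gi_gt0.
have cardb : #|saturated g c| = #|saturated g b|.+1.
  by rewrite satb (cardsD1 i) inE gi_le.
apply: (IHk b); [lia| |lia].
apply: contra nUc; apply: upward_le; first exact: trU.1.
by apply/mnm_lepP => l; rewrite mnmE; case: eqP.
Qed.

Lemma skeleton_dim U j c : truncated g U -> ~~ U c -> ~~ skeleton U j 0%MM ->
  (j <= #|saturated g c|)%N -> is_dim (ideal_of (skeleton U j)) j.
Proof.
move=> trU nUc; rewrite negb_or -leqNgt => /andP[_ le_0j] le_jc.
have [|b nUb satb] := saturated_level (j := j) trU nUc; first by rewrite le_0j.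
apply: (@monomial_ideal_dim K n g _ _ b (skeleton_truncated j trU)) => //.
  by rewrite /skeleton negb_or nUb satb ltnn.
by move=> e; rewrite negb_or -leqNgt => /andP[].
Qed.

(** If [I_j] is the unit ideal, then the kernel of [S/I -> S/I_j] is [S/I]
    itself, so [j] does not exceed the depth of [S/I] in this case either. *)
Lemma skeleton_CM U : truncated g U -> ~~ U 0%MM ->
  exists d t : nat,
    [/\ is_dim (ideal_of U) d, is_depth (max_ideal K n) (ideal_of U) t,
        is_max (fun j => (j <= d)%N /\
                  is_CM (max_ideal K n) (ideal_of (skeleton U j))) t
      & forall j, (j <= t)%N ->
          is_CM (max_ideal K n) (ideal_of (skeleton U j))].
Proof.
move=> trU nU0.
have [||d [[c nUc satc] dmax]] :=
    @bounded_is_max (fun l => exists2 c, ~~ U c & #|saturated g c| = l) n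
      #|saturated g 0%MM|.
- by exists 0%MM.
- by move=> _ [c _ <-]; rewrite -[leqRHS]card_ord max_card.
have le_d e : ~~ U e -> (#|saturated g e| <= d)%N.
  by move=> nUe; apply: dmax; exists e.
have [|l [s [<- _]]|t tdepth] := @bounded_is_max (depth_length U) d 0.
- exact: thetas_depth_length.
- exact: regular_size trU.1 le_d.
have [tlen tmax] := tdepth.
have le_td : (t <= d)%N.
  by have [s [<- _]] := tlen; apply: regular_size trU.1 le_d.
have CM j : (j <= t)%N -> is_CM (max_ideal K n) (ideal_of (skeleton U j)).
  move=> le_jt; have trS := skeleton_truncated j trU.
  have [S0|nS0] := boolP (skeleton U j 0%MM).
    left=> p e _; apply: upward_le S0; first exact: trS.1.
    by apply/mnm_lepP => i; rewrite mnm0E.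
  right; exists j; split.
    by apply: (skeleton_dim trU nUc nS0); rewrite satc (leq_trans le_jt).
  split; last first.
    have le_j e : ~~ skeleton U j e -> (#|saturated g e| <= j)%N.
      by rewrite negb_or -leqNgt => /andP[].
    by move=> l [s [<- _]]; apply: regular_size trS.1 le_j.
  apply: thetas_depth_length => //; apply: vanishes_thetas_regular => //.
    by move=> e lt_j; rewrite /skeleton lt_j orbT.
  move=> q le_qj; apply: skeleton_vanishes => //.
  by apply: depth_length_vanishes tlen _ => //; apply: leq_trans le_jt.
exists d, t; split=> //; first exact: (monomial_ideal_dim _ trU nUc satc le_d).
split=> [|j [le_jd CMj]]; first by split=> //; apply: CM.
have trS := skeleton_truncated j trU.
have Ui := @monomial_ideal_ideal K n _ trU.1.
have Si := @monomial_ideal_ideal K n _ trS.1.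
apply: tmax; apply: thetas_depth_length => //.
apply: (regular_extension full_ideal Ui Si) => //; first exact: sub_skeleton.
  exact: skeleton_kernel_regular.
case: CMj => [all|[d' [dim' depth']]].
  by apply: regular_trivial => // x _; apply: all.
have nS0 : ~~ skeleton U j 0%MM := depth_length_outside trS depth'.1.
have d'E : d' = j.
  by apply: is_max_unique dim' (skeleton_dim trU nUc nS0 _); rewrite satc.
rewrite d'E in depth'; apply: vanishes_thetas_regular => //.
  by move=> e lt_j; rewrite /skeleton lt_j orbT.
by move=> q; apply: depth_length_vanishes trS depth'.1.
Qed.

End Skeletons.

(** * Monomial ideals in terms of their minimal generators *)

Section MinimalGenerators.
Variables (K : fieldType) (n : nat) (I : {mpoly K[n]} -> Prop).
Implicit Types (a b c g : 'X_{1..n}) (G : 'X_{1..n} -> Prop).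

Lemma generates_ideal G : generates G I -> is_ideal I.
Proof. by move=> gI; rewrite (pred_ext gI); apply: ideal_gen_ideal. Qed.

(** The polynomials whose monomials are all divisible by some generator form an
    ideal, so this is where an element of [I] must lie. *)
Lemma generates_monomial G p c : generates G I -> I p -> c \in msupp p ->
  exists2 a, G a & (a <= c)%MM.
Proof.
move=> gI /gI; pose up (e : 'X_{1..n}) := decide (exists2 a, G a & (a <= e)%MM).
have upP e : up e <-> exists2 a, G a & (a <= e)%MM by apply: decideP.
have up_up : upward up.
  move=> e e' /upP[a Ga ae]; apply/upP; exists a => //.
  by apply: lepm_trans ae _; apply: lem_addr.
move=> /(_ (monomial_ideal up) (monomial_ideal_ideal K up_up)) Up cp.
apply/upP; apply: Up cp => _ [a Ga ->]; apply/monomial_idealX/upP.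
by exists a => //; apply: lepm_refl.
Qed.

Lemma generates_mem G a : generates G I -> G a -> I 'X_[a].
Proof. by move=> gI Ga; apply/gI; apply: ideal_gen_sub; exists a. Qed.

(** The elements of [I] that are minimal for divisibility generate it, since
    degrees decrease along proper divisors, and none of them can be left out.
    So there are enough minimal generators. *)
Lemma minimal_generator_le G c : generates G I -> I 'X_[c] ->
  exists2 a, is_minimal_generator I a & (a <= c)%MM.
Proof.
move=> gI; have Ii := generates_ideal gI.
pose M a := I 'X_[a] /\ forall b, I 'X_[b] -> (b <= a)%MM -> b = a.
have M_le e : I 'X_[e] -> exists2 a, M a & (a <= e)%MM.
  move: {2}(mdeg e) (leqnn (mdeg e)) => k; elim: k e => [|k IHk] e le_e Ie.
    exists e; last exact: lepm_refl.
    split=> // b _ le_be; move: le_e; rewrite leqn0 -(submK le_be) mdeg_eq0.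
    by rewrite mnmD_eq0 => /andP[/eqP-> /eqP->]; rewrite add0m.
  have [Me|nMe] := classic (M e); first by exists e => //; apply: lepm_refl.
  have [b [Ib le_be ne_be]] : exists b, [/\ I 'X_[b], (b <= e)%MM & b <> e].
    apply: NNPP => nb; apply: nMe; split=> // b Ib le_be; apply: NNPP => ne_be.
    by apply: nb; exists b.
  have [|a Ma le_ab] := IHk b _ Ib; last first.
    by exists a => //; apply: lepm_trans le_be.
  rewrite -ltnS; apply: leq_trans le_e.
  rewrite -(submK le_be) mdegD -add1n leq_add2r.
  rewrite lt0n mdeg_eq0; apply/eqP => e0; case: ne_be.
  by rewrite -(submK le_be) e0 add0m.
have gM : generates M I.
  move=> p; split=> [Ip|gp].
    have Mi := ideal_gen_ideal
      (fun q : {mpoly K[n]} => exists2 a, M a & q = 'X_[a]).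
    rewrite [p]mpolyE big_seq; apply: (ideal_sum _ Mi) => e ep.
    have [a Ga le_ae] := generates_monomial gI Ip ep.
    have Ie : I 'X_[e].
      rewrite -(submK le_ae) mpolyXD; apply: (idealM _ Ii).
      exact: generates_mem gI Ga.
    have [b Mb le_be] := M_le e Ie.
    rewrite -mul_mpolyC -(submK le_be) mpolyXD mulrA; apply: (idealM _ Mi).
    by apply: ideal_gen_sub; exists b.
  by apply: gp => // _ [a [Ia _] ->].
move=> /M_le[a Ma le_ac]; exists a => //; exists M => //.
split=> // H gH HM b Mb.
have [|e He le_eb] := generates_monomial gH Mb.1 (c := b).
  by rewrite msuppX inE.
by rewrite -(Mb.2 e) //; apply: (HM e He).1.
Qed.

Lemma monomial_ideal_truncated g : is_monomial_ideal I ->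
    (forall a, is_minimal_generator I a -> (a <= g)%MM) ->
  exists2 U, truncated g U & I = @monomial_ideal K n U.
Proof.
move=> [G gI] g_ge; have Ii := generates_ideal gI.
pose U (c : 'X_{1..n}) := decide (I 'X_[c]).
have UP c : U c <-> I 'X_[c] by apply: decideP.
exists U; first split=> [c e /UP Ic|c /UP Ic].
- by apply/UP; rewrite addmC mpolyXD; apply: (idealM _ Ii).
- have [a amin le_ac] := minimal_generator_le gI Ic.
  have [Ga [gGa _] Gaa] := amin.
  have le_a : (a <= truncate g c)%MM.
    apply/mnm_lepP => i; rewrite mnmE leq_min.
    by rewrite (mnm_lepP le_ac) (mnm_lepP (g_ge a amin)).
  apply/UP; rewrite -(submK le_a) mpolyXD; apply: (idealM _ Ii).
  exact: generates_mem gGa Gaa.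
apply: pred_ext => p; split=> [Ip c cp|Up].
  have [a Ga le_ac] := generates_monomial gI Ip cp.
  apply/UP; rewrite -(submK le_ac) mpolyXD; apply: (idealM _ Ii).
  exact: generates_mem gI Ga.
rewrite [p]mpolyE big_seq; apply: (ideal_sum _ Ii) => c /Up/UP Ic.
by rewrite -mul_mpolyC; apply: (idealM _ Ii).
Qed.

End MinimalGenerators.

Theorem corollary1p5 (K : fieldType) (n : nat) (I : {mpoly K[n]} -> Prop)
    (I_mon : is_monomial_ideal I) (I_proper : exists p, ~ I p)
    (g : 'X_{1..n})
    (g_ge : forall a, is_minimal_generator I a -> (a <= g)%MM) :
  exists d t : nat,
    [/\ is_dim I d, is_depth (max_ideal K n) I t,
        is_max (fun j => (j <= d)%N /\
                  is_CM (max_ideal K n) (skeleton_ideal g I j)) t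
      & forall j, (j <= t)%N ->
          is_CM (max_ideal K n) (skeleton_ideal g I j)].
Proof.
have [U trU IU] := monomial_ideal_truncated I_mon g_ge; subst I.
have nU0 : ~~ U 0%MM.
  have [p nUp] := I_proper; apply/negP => U0; apply: nUp => c _.
  by apply: upward_le U0; [exact: trU.1|apply/mnm_lepP => i; rewrite mnm0E].
have [d [t [dimI depthI maxI CMI]]] := @skeleton_CM K n g U trU nU0.
have E j := skeleton_idealE K j trU.
exists d, t; split=> // [|j /CMI]; last by rewrite E.
by split=> [|j []]; rewrite E; [exact: maxI.1|move=> ? ?; apply: maxI.2].
Qed.
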